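(* Assume CH. There is an automorphism of $\ell_\infty/c_0$ with no fountains and no funnels (i.e. fountainless and funnelless) which is nowhere trivial.
   Context: CH is the continuum hypothesis. $[f]$ is the class of $f$ modulo null functions. $\mathbb{N}^*=\beta\mathbb{N}\setminus\mathbb{N}$; $\ell_\infty/c_0$ is canonically identified with $C(\mathbb{N}^* )$, whose dual is identified with the Radon measures on $\mathbb{N}^*$; $T^\star$ is the adjoint of $T$. A measure $\mu$ is concentrated on $F$ if $|\mu|(\mathbb{N}^*\setminus F)=0$. An automorphism is a bounded linear bijection with bounded inverse. $T$ is fountainless (has no fountains) if for every nowhere dense $F\subseteq\mathbb{N}^*$ the set $\{y\in\mathbb{N}^*:T^\star(\delta_y)\text{ is nonzero and concentrated on }F\}$ is nowhere dense (it suffices to consider closed $F$). $T$ is funnelless (has no funnels) if for every nowhere dense $F\subseteq\mathbb{N}^*$ there is a nowhere dense $G\subseteq\mathbb{N}^*$ such that $T^\star(\delta_y)$ is concentrated on $G$ for all $y\in F$. For infinite $A,B\subseteq\mathbb{N}$: $I_A([g])=[g\cup 0_{\mathbb{N}\setminus A}]$ for $g\in\ell_\infty(A)$, $P_B([f])=[f|B]$, and $T_{B,A}=P_B\circ T\circ I_A$. $T$ is nowhere trivial if for no infinite $A,B\subseteq\mathbb{N}$ is $T_{B,A}$ trivial, where $T_{B,A}$ is trivial if there are $A'\subseteq A$ cofinite in $A$, $B'\subseteq B$ cofinite in $B$, a bijection $\sigma:B'\to A'$ and a nonzero real $r$ such that $T_{B,A}([f])=[rf\circ\sigma]$ for all $f\in\ell_\infty(A')$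 (with the obvious identifications modulo finite sets). *)

(* Defs.v *)
From HB Require Import structures.
From mathcomp Require Import all_boot all_order all_algebra.
From mathcomp Require Import all_classical all_reals all_analysis.
From mathcomp Require Import finmap lra.

Set Implicit Arguments.
Unset Strict Implicit.
Unset Printing Implicit Defensive.

Import Order.TTheory GRing.Theory Num.Theory.
Import numFieldNormedType.Exports.

Local Open Scope classical_set_scope.
Local Open Scope ring_scope.
Local Open Scope card_scope.

Definition CH : Prop :=
  forall X : set (set nat), countable X \/ X #= [set: set nat].

Section linf.
Variables (R : realType) (I : Type).

Definition bounded_family : {pred I -> R^o} :=
  [pred f | `[< exists M : R, forall i, `|f i| <= M >]].

Lemma bounded_familyP (f : I -> R^o) :
  reflect (exists M : R, forall i, `|f i| <= M) (f \in bounded_family).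
Proof. exact: asboolP. Qed.

Let bounded_family_submod : submod_closed bounded_family.
Proof.
split; first by apply/bounded_familyP; exists 0 => i; rewrite normr0.
move=> a f g /bounded_familyP[M fM] /bounded_familyP[N gN].
apply/bounded_familyP; exists (`|a| * M + N) => i.
rewrite (le_trans (ler_normD _ _))// lerD// normrM.
by rewrite ler_wpM2l.
Qed.

HB.instance Definition _ :=
  GRing.isSubmodClosed.Build R (I -> R^o) bounded_family bounded_family_submod.

Record linf := Linf { linf_fun :> I -> R^o ; _ : linf_fun \in bounded_family }.

HB.instance Definition _ := [isSub for linf_fun].
HB.instance Definition _ := [Choice of linf by <:].
HB.instance Definition _ := [SubChoice_isSubLmodule of linf by <:].

Lemma linfP (f : linf) : exists M : R, forall i, `|f i| <= M.
Proof. by case: f => f /= /bounded_familyP. Qed.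

Definition sup_norm (f : linf) : R := sup (range (fun i => `|f i|)).

Lemma le_sup_norm (f : linf) i : `|f i| <= sup_norm f.
Proof.
have [M fM] := linfP f.
by apply: ub_le_sup; [exists M => _ [j _ <-]|exists i].
Qed.

Lemma sup_norm_ge0 (f : linf) : 0 <= sup_norm f.
Proof.
have [[_ [i _ _]]|/set0P/negP/negPn/eqP e] :=
    pselect (range (fun i => `|f i|) !=set0).
  exact: le_trans (le_sup_norm f i).
by rewrite /sup_norm e sup0.
Qed.

Lemma sup_norm_le (f : linf) M : 0 <= M -> (forall i, `|f i| <= M) ->
  sup_norm f <= M.
Proof.
move=> M0 fM.
have [ne|/set0P/negP/negPn/eqP e] := pselect (range (fun i => `|f i|) !=set0).
  by apply: ge_sup => // _ [j _ <-].
by rewrite /sup_norm e sup0.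
Qed.

Let sup_normD f g : sup_norm (f + g) <= sup_norm f + sup_norm g.
Proof.
apply: sup_norm_le => [|i]; first by rewrite addr_ge0 ?sup_norm_ge0.
by rewrite (le_trans (ler_normD _ _))// lerD// le_sup_norm.
Qed.

Let sup_normZ (a : R) f : sup_norm (a *: f) = `|a| * sup_norm f.
Proof.
have leZ (b : R) g : sup_norm (b *: g) <= `|b| * sup_norm g.
  apply: sup_norm_le => [|i]; first by rewrite mulr_ge0 ?sup_norm_ge0.
  by rewrite [X in X <= _]normrM ler_wpM2l// le_sup_norm.
apply/eqP; rewrite eq_le leZ/=.
have [->|a0] := eqVneq a 0; first by rewrite normr0 mul0r sup_norm_ge0.
rewrite -ler_pdivlMl ?normr_gt0// -normfV.
by rewrite -[X in sup_norm X <= _](scalerK a0) leZ.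
Qed.

Let sup_norm0_eq0 f : sup_norm f = 0 -> f = 0.
Proof.
move=> f0; apply/val_inj/funext => i /=.
by apply/normr0_eq0/le_anti; rewrite normr_ge0 andbT -f0 le_sup_norm.
Qed.

HB.instance Definition _ :=
  Lmodule_isNormed.Build R linf sup_normD sup_normZ sup_norm0_eq0.

Lemma linf_normE (f : linf) : `|f| = sup (range (fun i => `|f i|)).
Proof. by []. Qed.

(* "f i tends to 0 along the cofinite filter"; for I = nat this is the usual
   notion of null sequence, see c0_natP. *)
Definition c0 : {pred linf} :=
  [pred f : linf | `[< forall e : R, 0 < e -> finite_set [set i | e <= `|f i|] >]].

Lemma c0P (f : linf) : reflect
  (forall e : R, 0 < e -> finite_set [set i | e <= `|f i|]) (f \in c0).
Proof. exact: asboolP. Qed.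

Lemma c0_submod : submod_closed c0.
Proof.
split.
  apply/c0P => e e0; rewrite (_ : [set _ | _] = set0)//.
  by rewrite -subset0 => i /=; rewrite normr0 leNgt e0.
move=> a f g /c0P f0 /c0P g0; apply/c0P => e e0.
have a1 : 0 < `|a| + 1 by rewrite ltr_wpDl.
have d0 : 0 < e / 2 / (`|a| + 1) by rewrite !divr_gt0.
have e20 : 0 < e / 2 by rewrite divr_gt0.
apply: sub_finite_set (_ : _ `<=` [set i | e / 2 / (`|a| + 1) <= `|f i|] `|`
                               [set i | e / 2 <= `|g i|]) _; last first.
  by rewrite finite_setU; split; [exact: f0|exact: g0].
move=> i /= ei; apply/orP; apply: contraLR ei.
rewrite negb_or -!ltNge => /andP[fi gi].
rewrite (le_lt_trans (ler_normD _ _))// [ltRHS]splitr.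
apply: ler_ltD => //; rewrite [X in X <= _]normrM.
apply: (@le_trans _ _ ((`|a| + 1) * `|f i|)).
  by rewrite ler_wpM2r// lerDl.
by rewrite mulrC -ler_pdivlMr// ltW.
Qed.

HB.instance Definition _ := GRing.isSubmodClosed.Build R linf c0 c0_submod.

End linf.
Arguments c0 {R I}.

Section linf_c0.
Variables (R : realType) (I : Type).
Local Notation linf := (linf R I).
Local Open Scope quotient_scope.

Definition linf_c0 : Type := Quotient.quot (c0 : zmodClosed linf).
HB.instance Definition _ := GRing.Zmodule.on linf_c0.
HB.instance Definition _ := EqQuotient.on linf_c0.

(* [f] *)
Definition cls (f : linf) : linf_c0 := \pi_linf_c0 f.

Lemma clsP (f g : linf) : cls f = cls g <-> f - g \in c0.
Proof.
rewrite /cls; split => [/eqP|h]; last apply/eqP; by rewrite -Quotient.idealrBE.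
Qed.

Lemma repr_cls (x : linf_c0) : cls (repr x) = x.
Proof. exact: reprK. Qed.

Lemma cls_is_zmod_morphism : zmod_morphism cls.
Proof. exact: pi_is_zmod_morphism. Qed.

HB.instance Definition _ :=
  GRing.isZmodMorphism.Build linf linf_c0 cls cls_is_zmod_morphism.

Definition scale_c0 (a : R) (x : linf_c0) : linf_c0 := cls (a *: repr x).

Lemma scale_c0_cls a f : scale_c0 a (cls f) = cls (a *: f).
Proof.
apply/clsP; rewrite -scalerBr; apply: rpredZ.
by apply/clsP; rewrite repr_cls.
Qed.

Let scale_c0A a b x : scale_c0 a (scale_c0 b x) = scale_c0 (a * b) x.
Proof. by rewrite [X in scale_c0 _ X]/scale_c0 scale_c0_cls scalerA. Qed.

Let scale_c01 : left_id 1 scale_c0.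
Proof. by move=> x; rewrite /scale_c0 scale1r repr_cls. Qed.

Let scale_c0Dr : right_distributive scale_c0 +%R.
Proof.
move=> a x y; rewrite -[x in LHS]repr_cls -[y in LHS]repr_cls.
by rewrite -raddfD scale_c0_cls scalerDr raddfD.
Qed.

Let scale_c0Dl x : {morph scale_c0^~ x : a b / a + b}.
Proof. by move=> a b; rewrite /scale_c0 scalerDl raddfD. Qed.

HB.instance Definition _ := GRing.Zmodule_isLmodule.Build R linf_c0
  scale_c0A scale_c01 scale_c0Dr scale_c0Dl.

Lemma cls_scalable : scalable cls.
Proof. by move=> a f; rewrite -scale_c0_cls. Qed.

HB.instance Definition _ :=
  GRing.isScalable.Build R linf linf_c0 *:%R cls cls_scalable.

Definition quot_norm (x : linf_c0) : R := inf [set `|f| | f in [set f | cls f = x]].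

Lemma quot_norm_le f : quot_norm (cls f) <= `|f|.
Proof. by apply: ge_inf; [exists 0 => _ [g _ <-]|exists f]. Qed.

Lemma quot_norm_ge x r : (forall f, cls f = x -> r <= `|f|) -> r <= quot_norm x.
Proof.
move=> h; apply: lb_le_inf; first by exists `|repr x|, (repr x); rewrite /= ?repr_cls.
by move=> _ [f fx <-]; exact: h.
Qed.

Let quot_normD x y : quot_norm (x + y) <= quot_norm x + quot_norm y.
Proof.
rewrite -lerBlDr; apply: quot_norm_ge => f fx.
rewrite lerBlDr -lerBlDl; apply: quot_norm_ge => g gy.
rewrite lerBlDl -fx -gy -raddfD (le_trans (quot_norm_le _))//.
exact: ler_normD.
Qed.

Let quot_normZ (a : R) x : quot_norm (a *: x) = `|a| * quot_norm x.
Proof.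
have leZ (b : R) z : b != 0 -> quot_norm (b *: z) <= `|b| * quot_norm z.
  move=> b0; rewrite -ler_pdivrMl ?normr_gt0//; apply: quot_norm_ge => f <-.
  by rewrite ler_pdivrMl ?normr_gt0// -normrZ -linearZ quot_norm_le.
have [->|a0] := eqVneq a 0.
  rewrite normr0 mul0r scale0r; apply/le_anti/andP; split.
    by rewrite -(raddf0 cls) (le_trans (quot_norm_le _))// normr0.
  exact: quot_norm_ge.
apply/eqP; rewrite eq_le leZ//= -ler_pdivlMl ?normr_gt0// -normfV.
by rewrite -[X in quot_norm X <= _](scalerK a0) leZ ?invr_eq0.
Qed.

Let quot_norm0_eq0 x : quot_norm x = 0 -> x = 0.
Proof.
move=> x0; rewrite -[x]repr_cls -(raddf0 cls); apply/clsP; rewrite subr0.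
apply/c0P => e e0; have e20 : 0 < e / 2 by rewrite divr_gt0.
have [||_ [g gx <-] ge] :=
    @inf_lt _ [set `|f| | f in [set f | cls f = x]] (e / 2).
- by exists `|repr x|, (repr x); rewrite /= ?repr_cls.
- by rewrite -/(quot_norm x) x0.
 have /clsP/c0P/(_ _ e20) : cls (repr x) = cls g.
  by rewrite repr_cls.
apply: sub_finite_set => i /= ei.
have {}ge : `|g i| < e / 2 by exact: le_lt_trans (le_sup_norm g i) ge.
have : `|repr x i| <= `|repr x i - g i| + `|g i|.
  by rewrite -[X in `|X| <= _](subrK (g i)) ler_normD.
by rewrite [e]splitr in ei *; lra.
Qed.

HB.instance Definition _ :=
  Lmodule_isNormed.Build R linf_c0 quot_normD quot_normZ quot_norm0_eq0.

Lemma linf_c0_normE (x : linf_c0) :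
  `|x| = inf [set `|f| | f in [set f | cls f = x]].
Proof. by []. Qed.

End linf_c0.

Lemma finite_nat_ub (A : set nat) : finite_set A -> exists N, A `<=` `I_N.
Proof.
move=> finA; exists (\max_(i <- fset_set A) i).+1 => n An /=.
by rewrite ltnS; apply: leq_bigmax_seq => //; rewrite in_fset_set// mem_set.
Qed.

Lemma c0_natP (R : realType) (f : linf R nat) :
  (f \in c0) <-> ((f : nat -> R) @ \oo --> (0 : R)).
Proof.
split=> [/c0P f0|/cvgrPdist_lt f0].
  apply/cvgrPdist_lt => e /f0 fin.
  have [N finN] := finite_nat_ub fin.
  exists N => // n /= Nn; rewrite sub0r normrN ltNge; apply/negP => /finN /=.
  by rewrite ltnNge Nn.
apply/c0P => e /f0[N _ fN]; apply: sub_finite_set (finite_II N) => n /= en.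
rewrite ltnNge; apply/negP => /fN /=.
by rewrite sub0r normrN ltNge en.
Qed.

Section operators.
Variable R : realType.

Lemma linf_comp_subproof (I J : Type) (s : I -> J) (f : linf R J) :
  (fun i => f (s i)) \in @bounded_family R I.
Proof. by have [M fM] := linfP f; apply/bounded_familyP; exists M. Qed.

Definition linf_comp (I J : Type) (s : I -> J) (f : linf R J) : linf R I :=
  Linf (linf_comp_subproof s f).

Lemma zero_ext_subproof (I : Type) (A : set I) (g : linf R A) :
  (fun i => oapp g 0 (insub i)) \in @bounded_family R I.
Proof.
have [M gM] := linfP g; apply/bounded_familyP; exists `|M| => i.
by case: insubP => [u _ _|_] /=;
  rewrite ?normr0// (le_trans (gM u))// ler_norm.
Qed.

(* g \cup 0_{I \ A} *)
Definition zero_ext (I : Type) (A : set I) (g : linf R A) : linf R I :=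
  Linf (zero_ext_subproof g).

Definition restr (I : Type) (B : set I) (f : linf R I) : linf R B :=
  linf_comp val f.

Definition I_ (I : Type) (A : set I) (x : linf_c0 R A) : linf_c0 R I :=
  cls (zero_ext (repr x)).

Definition P_ (I : Type) (B : set I) (x : linf_c0 R I) : linf_c0 R B :=
  cls (restr B (repr x)).

Lemma I_cls (I : Type) (A : set I) (g : linf R A) :
  I_ (cls g) = cls (zero_ext g).
Proof.
have /clsP/c0P gg : cls (repr (cls g)) = cls g by rewrite repr_cls.
apply/clsP/c0P => e e0.
apply: sub_finite_set (finite_image val (gg e e0)) => i /=.
rewrite [X in _ <= `|X|](_ : _ = oapp (repr (cls g) - g) 0 (insub i)).
  by case: insubP => [u _ <- ?|_] /=; [exists u|rewrite normr0 leNgt e0].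
rewrite [LHS](_ : _ = oapp (repr (cls g)) 0 (insub i) - oapp g 0 (insub i))//.
by case: insub => [u|] //=; rewrite subrr.
Qed.

Lemma P_cls (I : Type) (B : set I) (f : linf R I) :
  P_ B (cls f) = cls (restr B f).
Proof.
have /clsP/c0P ff : cls (repr (cls f)) = cls f by rewrite repr_cls.
apply/clsP/c0P => e e0.
apply: sub_finite_set (finite_preimage _ (ff e e0)); last first.
  by move=> x y _ _; exact: val_inj.
by move=> i /= ei.
Qed.

End operators.

Section Nstar.

(* Points of beta N \ N: ultrafilters on N that are not the principal filter of a
   point of N. *)
Record Nstar := MkNstar {
  Nstar_filter :> set_system nat ;
  Nstar_ultra : UltraFilter Nstar_filter ;
  Nstar_free : forall n, Nstar_filter <> principal_filter n }.

HB.instance Definition _ := gen_eqMixin Nstar.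
HB.instance Definition _ := gen_choiceMixin Nstar.

#[global] Instance Nstar_proper (y : Nstar) : ProperFilter y.
Proof. exact: @ultra_proper _ _ (Nstar_ultra y). Qed.

Let Nstar_exists : exists y : Nstar, True.
Proof.
have [F [FU ooF]] := ultraFilterLemma eventually_filter.
suff Ffree n : F <> principal_filter n by exists (MkNstar FU Ffree).
move=> Fn; have : F [set m | (n < m)%N] by apply: ooF; exists n.+1.
by rewrite Fn => /principal_filterP /=; rewrite ltnn.
Qed.

HB.instance Definition _ := isPointed.Build Nstar (projT1 (cid Nstar_exists)).

(* the basic (clopen) sets A^* *)
Definition star (A : set nat) : set Nstar := [set y | Nstar_filter y A].

Let star_cover : \bigcup_(A in [set: set nat]) star A = setT.
Proof.
by rewrite -subTset => y _; exists setT => //; exact: filterT.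
Qed.

Let star_join (A B : set nat) (y : Nstar) : [set: set nat] A ->
  [set: set nat] B -> star A y -> star B y ->
  exists C, [/\ [set: set nat] C, star C y & star C `<=` star A `&` star B].
Proof.
move=> _ _ yA yB; exists (A `&` B); split => //; first exact: filterI.
move=> z zAB; split; apply: filterS zAB; first exact: subIsetl.
exact: subIsetr.
Qed.

HB.instance Definition _ :=
  isBaseTopological.Build Nstar star_cover star_join.

Lemma star_open (A : set nat) : open (star A).
Proof. by exists [set A] => //; rewrite bigcup_set1. Qed.

Lemma Nstar_cofinite (y : Nstar) (A : set nat) : finite_set A -> star (~` A) y.
Proof.
move=> /finite_nat_ub[N AN]; rewrite /star/=.
suff yN : Nstar_filter y (~` `I_N) by exact: filterS (subsetC AN) yN.
elim: N {A AN} => [|N IH].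
  by apply: filterS (@filterT _ y _) => n _ /=; rewrite ltn0.
have yn : Nstar_filter y (~` [set N]).
  have [yN|//] := in_ultra_setVsetC [set N] (Nstar_ultra y).
  case: (@Nstar_free y N); rewrite predeqE => U.
  rewrite principal_filterP; split => [yU|UN].
    by have [_ [-> //]] := filter_ex (filterI yN yU).
  by apply: filterS yN => _ ->.
apply: filterS (filterI yn IH) => n [/= /eqP nN nN1].
by apply/negP; rewrite ltnS leq_eqVlt negb_or nN/=; apply/negP.
Qed.

End Nstar.

Definition nowhere_dense (T : topologicalType) (F : set T) : Prop :=
  interior (closure F) = set0.

Section measures.
Variable R : realType.

Definition borelNstar := g_sigma_algebraType (@open Nstar).
HB.instance Definition _ := Measurable.on borelNstar.
HB.instance Definition _ := Pointed.on borelNstar.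

Implicit Types nu : {charge set borelNstar -> \bar R}.

Definition hahn_pos nu : set borelNstar :=
  projT1 (cid (Hahn_decomposition nu)).
Definition hahn_neg nu : set borelNstar :=
  projT1 (cid (projT2 (cid (Hahn_decomposition nu)))).
Definition hahnP nu : hahn_decomposition nu (hahn_pos nu) (hahn_neg nu) :=
  projT2 (cid (projT2 (cid (Hahn_decomposition nu)))).

(* the measure |nu| *)
Definition tot_var nu : {measure set borelNstar -> \bar R} :=
  charge_variation (hahnP nu).

Definition charge_integral nu (f : borelNstar -> R) : R :=
  Rintegral (jordan_pos (hahnP nu)) setT f -
  Rintegral (jordan_neg (hahnP nu)) setT f.

(* finiteness is part of the definition of a charge *)
Definition radon nu : Prop := forall A : set borelNstar, measurable A ->
  tot_var nu A =
  ereal_sup [set tot_var nu K |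
             K in [set K : set Nstar | compact K /\ K `<=` A]].

(* Nstar \ F is null for (the completion of) |nu|; F need not be Borel *)
Definition concentrated nu (F : set Nstar) : Prop :=
  (tot_var nu).-negligible (~` F : set borelNstar).

End measures.

Section duality.
Variable R : realType.
Local Notation X := (linf_c0 R nat).

(* the element of C(Nstar) identified with x : on [f] it is the continuous
   extension of f, see hat_cls *)
Definition hat (x : X) (y : Nstar) : R := lim ((repr x : nat -> R) n @[n --> Nstar_filter y]).

Lemma cvg_ultra (f : linf R nat) (y : Nstar) :
  cvg ((f : nat -> R) n @[n --> Nstar_filter y]).
Proof.
have [M fM] := linfP f.
have yM : ((f : nat -> R) n @[n --> Nstar_filter y]) `[- M, M]%classic.
  apply: (filterS _ (@filterT _ y _)) => n _ /=.
  by rewrite in_itv/= -ler_norml.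
have [p [_ pc]] := @segment_compact R (- M) M _ _ yM.
apply/cvg_ex; exists p => U /= pU.
have [//|yU] := in_ultra_setVsetC (f @^-1` U) (Nstar_ultra y).
have [z [/= ? ?]] : (~` U) `&` U !=set0 by exact: pc.
by [].
Qed.

Lemma hat_cls (f : linf R nat) (y : Nstar) :
  hat (cls f) y = lim ((f : nat -> R) n @[n --> Nstar_filter y]).
Proof.
have /cvg_ex[l fl] := @cvg_ultra f y; rewrite (cvg_lim _ fl)//.
apply: cvg_lim => //; apply/cvgrPdist_lt => e e0.
have e20 : 0 < e / 2 by rewrite divr_gt0.
have /clsP/c0P/(_ _ e20)/(Nstar_cofinite y) ff : cls (repr (cls f)) = cls f.
  by rewrite repr_cls.
move/cvgrPdist_lt : fl => /(_ _ e20) fl.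
apply: filterS (filterI ff fl) => n [/= /negP]; rewrite -ltNge.
move=> un ln; rewrite [ltRHS]splitr.
rewrite (_ : l - _ = (l - f n) - (repr (cls f) n - f n)); last first.
  by rewrite opprB addrA subrK.
by rewrite (le_lt_trans (ler_normB _ _))// ltrD.
Qed.

Lemma hat_continuous (x : X) : continuous (hat x).
Proof.
have cv (z : Nstar) e : 0 < e ->
    star [set n | `|hat x z - (repr x : nat -> R) n| < e] z.
  have /cvgrPdist_lt := @cvg_ultra (repr x) z; exact.
move=> y; apply/(@cvgrPdist_lt _ _ _ (nbhs y) (nbhs_filter y)) => e e0.
have e20 : 0 < e / 2 by rewrite divr_gt0.
apply: filterS (open_nbhs_nbhs (conj (star_open _) (cv y _ e20))) => z /= yz.
have [n [/= ny nz]] := filter_ex (filterI yz (cv z _ e20)).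
rewrite -(subrK ((repr x : nat -> R) n) (hat x y)) -addrA [ltRHS]splitr.
by rewrite (le_lt_trans (ler_normD _ _))// ltrD// distrC.
Qed.

Definition delta (y : Nstar) : X -> R := fun x => hat x y.

Definition adjoint (T : X -> X) (phi : X -> R) : X -> R := phi \o T.

(* the identification of functionals on C(Nstar) with Radon measures *)
Definition represents (nu : {charge set borelNstar -> \bar R}) (phi : X -> R) :
    Prop :=
  radon nu /\ forall x, phi x = charge_integral nu (hat x).

Definition functional_concentrated (phi : X -> R) (F : set Nstar) : Prop :=
  exists nu, represents nu phi /\ concentrated nu F.

Definition fountainless (T : X -> X) : Prop :=
  forall F : set Nstar, nowhere_dense F ->
    nowhere_dense [set y | (exists x, adjoint T (delta y) x != 0) /\
                           functional_concentrated (adjoint T (delta y)) F].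

Definition funnelless (T : X -> X) : Prop :=
  forall F : set Nstar, nowhere_dense F ->
    exists G : set Nstar, nowhere_dense G /\
      forall y, F y -> functional_concentrated (adjoint T (delta y)) G.

Definition bounded_operator (T : X -> X) : Prop :=
  exists M : R, forall x, `|T x| <= M * `|x|.

Definition automorphism (T : {linear X -> X}) : Prop :=
  bounded_operator T /\
  exists S : X -> X, [/\ cancel T S, cancel S T & bounded_operator S].

Definition local_op (T : X -> X) (B A : set nat) : linf_c0 R A -> linf_c0 R B :=
  fun x => P_ B (T (I_ x)).

(* A' and B' are subsets of the types A and B; l_infty/c_0 over A' (resp. B')
   is identified with l_infty/c_0 over A (resp. B) by extension by zero on the
   finite complement. *)
Definition trivial_op (A B : set nat) (T : linf_c0 R A -> linf_c0 R B) : Prop :=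
  exists (A' : set A) (B' : set B) (s : B' -> A') (r : R),
    [/\ cofinite_set A', cofinite_set B', bijective s, r != 0 &
        forall f : linf R A', T (I_ (cls f)) = I_ (cls (r *: linf_comp s f))].

Definition nowhere_trivial (T : X -> X) : Prop :=
  forall A B : set nat, infinite_set A -> infinite_set B ->
    ~ trivial_op (@local_op T B A).

End duality.

(* Main.v *)
From HB Require Import structures.
Require Import Defs.
From mathcomp Require Import all_boot all_order all_algebra.
From mathcomp Require Import all_classical all_reals all_analysis.
From mathcomp Require Import wochoice zify lra.

Set Implicit Arguments.
Unset Strict Implicit.
Unset Printing Implicit Defensive.

Import Order.TTheory GRing.Theory Num.Theory.
Import numFieldNormedType.Exports.

Local Open Scope classical_set_scope.
Local Open Scope ring_scope.

(** Under CH the Boolean algebra of subsets of nat modulo finite sets has an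
automorphism that agrees with no injection of an infinite set of integers; the
composition operator of its Stone dual is the required operator.

Given a homeomorphism h of Nstar, let T send x to the class whose continuous
extension is the extension of x composed with h. The adjoint of T maps the point
mass at y to the point mass at h y, which is concentrated on F only if h y lies
in the closure of F, and is concentrated on every set that contains h y. As h and
its inverse preserve nowhere dense sets, T has neither fountains nor funnels
([composition_fountainless], [composition_funnelless]). If a corner of T were
given by r and a bijection sigma between sets of integers, then T would send the
indicator of c, for each c in the range of sigma, to r times the indicator of
the preimage of c, up to a null sequence. So it is enough that for each
injection sigma of an infinite set B the automorphism underlying h moves some
subset c of the range of sigma to a class d that misses infinitely many points
of the preimage of c ([composition_nowhere_trivial]).

Such an automorphism is a subalgebra of the pairs of sets of integers, with
full projections, in which a pair has a finite first entry exactly when its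
second entry is finite. It is the union of an increasing chain of countable
subalgebras of this kind ([CH_escaping_automorphism]). CH well-orders the sets
of integers with countable initial segments ([CH_order]), so a recursion that
only ever takes unions of countable chains reaches every set of integers
([generic_chain]); the stage of w puts w in both projections and, when w codes
an injection, escapes from that injection. Putting c in the first projection means
solving countably many conditions on d: for every pair (a, b) already present, b
meets d, and b leaves d, in a finite set exactly when a does so with c. A
countable system of this kind can be solved as soon as its obvious consistency
conditions hold ([interpolation]). To escape from s on B, the set c is
first chosen inside the image of B so thin that the present algebra contains no
infinite part of c, and none of the preimage of c; nothing then prevents d from
being almost disjoint from that preimage ([compatible_escape]).

The operator is built from h through binary expansions: a sequence with values in
the unit interval is the sum of the indicators of its digit sets a_k weighted by
2^-(k+1), and its image is the same sum over sets b_k that correspond to a_k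
([dual_operator_value]). *)

(** * Sets of integers and countable sets *)

Lemma infinite_natP (A : set nat) :
  infinite_set A <-> forall k, exists2 x, (k <= x)%N & A x.
Proof.
split=> [Ainf k|Aunb /finite_nat_ub[N AN]]; last first.
  by have [x Nx /AN /=] := Aunb N; rewrite ltnNge Nx.
apply: contrapT => noA; apply: Ainf; apply: sub_finite_set (finite_II k) => x Ax /=.
by rewrite ltnNge; apply/negP => kx; apply: noA; exists x.
Qed.

Lemma countable_setU T (A B : set T) :
  countable A -> countable B -> countable (A `|` B).
Proof.
move=> Act Bct; have -> : A `|` B = \bigcup_(b in [set: bool]) if b then A else B.
  apply/seteqP; split=> [x [Ax|Bx]|x [[] _ ?]]; [|  |by left|by right].
    by exists true.
  by exists false.
by apply: bigcup_countable => // -[].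
Qed.

Lemma countable_range T (A : set T) :
  countable A -> A !=set0 -> exists e : nat -> T, range e = A.
Proof.
move=> Ac [x0 Ax0]; have [A0|[f]] := pfcard_geP Ac.
  by rewrite A0 in Ax0.
exists f; apply/seteqP; split=> [x [n _ <-]|x /(@surj _ _ _ _ f)[n _ <-]].
  exact: (@funS _ _ _ _ f n).
by exists n.
Qed.

Lemma finite_image_inj T U (A : set T) (f : T -> U) :
  {in A &, injective f} -> finite_set (f @` A) -> finite_set A.
Proof. by move=> /Pinj[g ->]; rewrite (eq_finite_set (card_image g)). Qed.

Lemma increasing_subset T (U : nat -> set T) m n :
  (forall k, U k `<=` U k.+1) -> (m <= n)%N -> U m `<=` U n.
Proof.
move=> Uincr; elim: n => [|n IH]; first by rewrite leqn0 => /eqP->.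
by rewrite leq_eqVlt => /orP[/eqP->//|/IH/subset_trans]; apply.
Qed.

(** * Interpolation and extension of countable subalgebras *)

(** Cut nat into consecutive intervals, from k m up to k m.+1, each long enough to meet
all the infinite sets in play by stage m, and let d be the complement of U m on the
even intervals and V m on the odd ones. Both choices avoid U m and contain
V m beyond the finite set where these overlap, while the even ones make d as large
as possible and the odd ones as small as possible. *)
Lemma interpolation (U V : nat -> set nat) (X : set (set nat)) :
    (forall n, U n `<=` U n.+1) -> (forall n, V n `<=` V n.+1) ->
    (forall n, finite_set (U n `&` V n)) -> countable X ->
  exists d, [/\ forall n, finite_set (U n `&` d),
    forall n, finite_set (V n `\` d),
    forall x, X x -> (forall n, infinite_set (x `\` U n)) ->
      infinite_set (x `&` d) &
    forall x, X x -> (forall n, infinite_set (x `\` V n)) ->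
      infinite_set (x `\` d)].
Proof.
move=> Uincr Vincr UVfin Xct.
have [e eX] : exists e : nat -> set nat, range e = [set set0] `|` X.
  by apply: countable_range; [exact: countable_setU|exists set0; left].
have eP x : X x -> exists i, e i = x.
  by move=> Xx; have [i _ <-] : range e x by [rewrite eX; right]; exists i.
(* U m and V m are disjoint from bnd m on, and wit A k is a point of A beyond k. *)
have [bnd bndP] := choice (fun n => finite_nat_ub (UVfin n)).
have [wit witP] : exists wit : set nat -> nat -> nat,
    forall A k, infinite_set A -> (k <= wit A k)%N /\ A (wit A k).
  suff /choice[f fP] : forall Ak : set nat * nat, exists x,
      infinite_set Ak.1 -> (Ak.2 <= x)%N /\ Ak.1 x.
    by exists (fun A k => f (A, k)) => A k; exact: fP (A, k).
  move=> [A k] /=; have [/infinite_natP/(_ k)[x kx Ax]|fA] := pselect (infinite_set A).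
    by exists x.
  by exists 0%N.
pose next m k := (k + bnd m.+1 +
  \sum_(i < m.+1) (wit (e i `\` U m) k + wit (e i `\` V m) k)).+1.
pose kk := fix kk m := if m is m'.+1 then next m' (kk m') else bnd 0%N.
have kk_lt m : (kk m < kk m.+1)%N by rewrite /= /next ltnS -addnA leq_addr.
have kk_bnd m : (bnd m <= kk m)%N.
  by case: m => //= m; rewrite /next; set s := \sum_(_ < _) _; lia.
have kk_wit i m : (i <= m)%N -> (wit (e i `\` U m) (kk m) < kk m.+1)%N /\
                              (wit (e i `\` V m) (kk m) < kk m.+1)%N.
  move=> im; have im1 : (i < m.+1)%N by [].
  rewrite /= /next (bigD1 (Ordinal im1))//=; set s := \sum_(_ < _ | _) _.
  by split; lia.
have kk_le m n : (m <= n)%N -> (kk m <= kk n)%N.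
  elim: n => [|n IH]; first by rewrite leqn0 => /eqP->.
  by rewrite leq_eqVlt => /orP[/eqP->//|/IH/leq_trans]; apply; exact: ltnW.
have kk_ge m : (m <= kk m)%N.
  by elim: m => // m IH; apply: leq_ltn_trans (kk_lt m).
have stage n x : (kk n <= x)%N -> exists2 m, (n <= m)%N & (kk m <= x < kk m.+1)%N.
  move=> nx; have [|m xm min] := @ex_minnP (fun m => x < kk m)%N.
    by exists x.+1; apply: leq_trans (kk_ge _).
  case: m xm min => [|m] xm min.
    by have := leq_ltn_trans nx xm; rewrite ltnNge (kk_le 0%N n).
  have mx : (kk m <= x)%N by rewrite leqNgt; apply/negP => /min; rewrite ltnn.
  exists m; last by rewrite mx.
  rewrite leqNgt; apply/negP => mn; have := kk_le m.+1 n mn.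
  by rewrite leqNgt (leq_ltn_trans nx).
have stage_uniq x m m' : (kk m <= x < kk m.+1)%N -> (kk m' <= x < kk m'.+1)%N -> m = m'.
  move=> /andP[mx xm] /andP[mx' xm'].
  have [/kk_le h|/kk_le h|//] := ssrnat.ltngtP m m'; lia.
have Umono m n : (m <= n)%N -> U m `<=` U n by exact: increasing_subset.
have Vmono m n : (m <= n)%N -> V m `<=` V n by exact: increasing_subset.
have UV m x : (kk m <= x)%N -> U m x -> V m x -> False.
  by move=> mx Ux Vx; have /= := bndP m x (conj Ux Vx); have := kk_bnd m; lia.
pose d := [set x | exists2 m, (kk m <= x < kk m.+1)%N & if odd m then V m x else ~ U m x].
exists d; split=> [n|n|x /eP[i <-] xU|x /eP[i <-] xV].
- apply: sub_finite_set (finite_II (kk n)) => x [Ux [m mx dx]] /=.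
  rewrite ltnNge; apply/negP => nx; have [m' nm' m'x] := stage _ _ nx.
  rewrite -(stage_uniq _ _ _ mx m'x) in nm'.
  have Umx := Umono _ _ nm' _ Ux.
  case: odd dx => // Vmx; apply: UV Umx Vmx; by case/andP: mx.
- apply: sub_finite_set (finite_II (kk n)) => x [Vx ndx] /=.
  rewrite ltnNge; apply/negP => nx; have [m nm mx] := stage _ _ nx.
  apply: ndx; exists m => //; have Vmx := Vmono _ _ nm _ Vx.
  case: odd => // Umx; apply: UV Umx Vmx; by case/andP: mx.
- apply/infinite_natP => k; pose m := (i + k).*2.
  have im : (i <= m)%N by rewrite /m; lia.
  have [kw [ew Uw]] := witP _ (kk m) (xU m).
  have [wk _] := kk_wit i m im.
  exists (wit (e i `\` U m) (kk m)).
    by apply: leq_trans kw; apply: leq_trans (kk_ge m); rewrite /m; lia.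
  by split=> //; exists m; rewrite ?kw ?wk// odd_double.
- apply/infinite_natP => k; pose m := (i + k).*2.+1.
  have im : (i <= m)%N by rewrite /m; lia.
  have [kw [ew Vw]] := witP _ (kk m) (xV m).
  have [_ wk] := kk_wit i m im.
  exists (wit (e i `\` V m) (kk m)).
    by apply: leq_trans kw; apply: leq_trans (kk_ge m); rewrite /m; lia.
  split=> // -[m' m'w]; rewrite (stage_uniq _ _ _ m'w (_ : (kk m <= _ < _)%N)) ?kw ?wk//.
  by rewrite /m /= odd_double.
Qed.

(** A subalgebra of pairs of sets with this last property is the graph of an
isomorphism between two subalgebras of the quotient of the power set of nat by
the finite sets: apply it to symmetric differences. *)
Definition fin_subalgebra (p : set (set nat * set nat)) : Prop :=
  [/\ p (setT, setT),
      forall a b, p (a, b) -> p (~` a, ~` b),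
      forall a b a' b', p (a, b) -> p (a', b') -> p (a `&` a', b `&` b') &
      forall a b, p (a, b) -> (finite_set a <-> finite_set b)].

Section fin_subalgebra.
Variable p : set (set nat * set nat).
Hypothesis pA : fin_subalgebra p.

Lemma fin_subalgebraT : p (setT, setT). Proof. by case: pA. Qed.

Lemma fin_subalgebraC a b : p (a, b) -> p (~` a, ~` b).
Proof. by case: pA => _ + _ _; apply. Qed.

Lemma fin_subalgebraI a b a' b' :
  p (a, b) -> p (a', b') -> p (a `&` a', b `&` b').
Proof. by case: pA => _ _ + _; apply. Qed.

Lemma fin_subalgebra_fin a b : p (a, b) -> (finite_set a <-> finite_set b).
Proof. by case: pA => _ _ _; apply. Qed.

Lemma fin_subalgebra0 : p (set0, set0).
Proof. by rewrite -setCT; apply/fin_subalgebraC/fin_subalgebraT. Qed.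

Lemma fin_subalgebraU a b a' b' :
  p (a, b) -> p (a', b') -> p (a `|` a', b `|` b').
Proof.
move=> pab pab'; rewrite -[a `|` a']setCK -[b `|` b']setCK !setCU.
by apply/fin_subalgebraC/fin_subalgebraI; apply: fin_subalgebraC.
Qed.

Lemma fin_subalgebraD a b a' b' :
  p (a, b) -> p (a', b') -> p (a `\` a', b `\` b').
Proof. by move=> pab pab'; apply/fin_subalgebraI/fin_subalgebraC. Qed.

End fin_subalgebra.

Definition swap (p : set (set nat * set nat)) : set (set nat * set nat) :=
  [set ab | p (ab.2, ab.1)].

Lemma swap_fin_subalgebra p : fin_subalgebra p -> fin_subalgebra (swap p).
Proof.
case=> p1 pC pI pf; split => //= [a b /pC//|a b a' b'|a b /pf[ab ba]//].
exact: pI.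
Qed.

Definition compatible (p : set (set nat * set nat)) (c d : set nat) : Prop :=
  forall a b, p (a, b) -> (finite_set (a `&` c) <-> finite_set (b `&` d)) /\
                        (finite_set (a `\` c) <-> finite_set (b `\` d)).

(** The subalgebra generated by p and the pair (c, d), when p is a subalgebra. *)
Definition adjoin (p : set (set nat * set nat)) (c d : set nat) :=
  [set xy | exists a b a' b', [/\ p (a, b), p (a', b') &
    xy = ((a `&` c) `|` (a' `\` c), (b `&` d) `|` (b' `\` d))]].

Lemma adjoin_sub p c d : p `<=` adjoin p c d.
Proof.
move=> [a b] pab; exists a, b, a, b; split=> //.
by rewrite !setDE -!setIUr !setUv !setIT.
Qed.

Lemma adjoin_mem p c d : fin_subalgebra p -> adjoin p c d (c, d).
Proof.
move=> pA; exists setT, setT, set0, set0; split.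
- exact: fin_subalgebraT.
- exact: fin_subalgebra0.
- by rewrite !setTI !set0D !setU0.
Qed.

Lemma adjoin_countable p c d : countable p -> countable (adjoin p c d).
Proof.
move=> pct; pose mix (q : (set nat * set nat) * (set nat * set nat)) :=
  ((q.1.1 `&` c) `|` (q.2.1 `\` c), (q.1.2 `&` d) `|` (q.2.2 `\` d)).
apply: (@sub_countable _ _ _ (p `*` p)); last exact: countableX.
apply: card_le_trans (card_image_le mix _); apply: subset_card_le.
by move=> _ [a [b [a' [b' [pab pab' ->]]]]]; exists ((a, b), (a', b')).
Qed.

Lemma adjoin_fin_subalgebra p c d :
  fin_subalgebra p -> compatible p c d -> fin_subalgebra (adjoin p c d).
Proof.
move=> pA cd; split.
- by apply: adjoin_sub; exact: fin_subalgebraT.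
- move=> _ _ [a [b [a' [b' [pab pab' [-> ->]]]]]].
  exists (~` a), (~` b), (~` a'), (~` b').
  split; [exact: fin_subalgebraC|exact: fin_subalgebraC|].
  by congr (_, _); rewrite predeqE => x /=; [have := EM (c x)|have := EM (d x)];
    tauto.
- move=> _ _ _ _ [a [b [a' [b' [pab pab' [-> ->]]]]]] [u [v [u' [v' [puv puv' [-> ->]]]]]].
  exists (a `&` u), (b `&` v), (a' `&` u'), (b' `&` v').
  split; [exact: fin_subalgebraI|exact: fin_subalgebraI|].
  by congr (_, _); rewrite predeqE => x /=; [have := EM (c x)|have := EM (d x)];
    tauto.
- move=> _ _ [a [b [a' [b' [pab pab' [-> ->]]]]]].
  by rewrite !finite_setU; have [-> _] := cd _ _ pab; have [_ ->] := cd _ _ pab'.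
Qed.

(** Countable ideals are generated by increasing sequences, which is the form in
which [interpolation] takes the sets to be avoided or swallowed. *)
Lemma increasing_cofinal (I : set (set nat * set nat)) :
    countable I -> I (set0, set0) ->
    (forall a b a' b', I (a, b) -> I (a', b') -> I (a `|` a', b `|` b')) ->
  exists s : nat -> set nat * set nat, [/\ forall n, I (s n),
    forall n, (s n).2 `<=` (s n.+1).2 &
    forall a b, I (a, b) -> exists n, b `<=` (s n).2].
Proof.
move=> Ict I0 IU; have [e eI] := countable_range Ict (ex_intro _ _ I0).
have Ie n : I (e n) by rewrite -eI; exists n.
pose s := fix s n := if n is n'.+1 then
  ((s n').1 `|` (e n').1, (s n').2 `|` (e n').2) else (set0, set0).
exists s; split=> [n|n|a b].
- elim: n => //= n IH; apply: IU; first by case: (s n) IH.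
  by case: (e n) (Ie n).
- by move=> x /= sx; left.
- by rewrite -eI => -[n _ en]; exists n.+1 => x /= bx; right; rewrite en.
Qed.

Section extension.
Variable p : set (set nat * set nat).
Hypotheses (pA : fin_subalgebra p) (pct : countable p).

(** The ideal of those pairs whose first entry is almost disjoint from c: a partner
of c must be almost disjoint from all the second entries. *)
Lemma ideal_sequence c : exists s : nat -> set nat * set nat,
  [/\ forall n, p (s n) /\ finite_set ((s n).1 `&` c),
      forall n, (s n).2 `<=` (s n.+1).2 &
      forall a b, p (a, b) -> finite_set (a `&` c) -> exists n, b `<=` (s n).2].
Proof.
have [|||s [sI sincr scof]] :=
    @increasing_cofinal [set ab | p ab /\ finite_set (ab.1 `&` c)].
- by apply: sub_countable pct; apply: subset_card_le => x [].
- by split; [exact: fin_subalgebra0|rewrite /= set0I].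
- move=> a b a' b' [/= pab ac] [/= pab' ac']; split; first exact: fin_subalgebraU.
  by rewrite /= setIUl finite_setU.
- by exists s; split=> // a b pab ac; apply: (scof a).
Qed.

(** The consistency condition for [interpolation]: an element that meets c in an
infinite set is not almost covered by the ideal of c. *)
Lemma infinite_off_ideal c a b s : p s -> finite_set (s.1 `&` c) -> p (a, b) ->
  infinite_set (a `&` c) -> infinite_set (b `\` s.2).
Proof.
case: s => a' b' ps /= fs pab; apply: contra_not => fb.
have [_ /(_ fb) fa] := fin_subalgebra_fin pA (fin_subalgebraD pA pab ps).
apply: sub_finite_set (_ : _ `<=` (a `\` a') `|` (a' `&` c)) _.
  by move=> x [ax cx]; have [a'x|na'x] := EM (a' x); [right|left].
by rewrite finite_setU.
Qed.

(** Countable saturation of the algebra of sets modulo finite sets: the type of c over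
a countable subalgebra is realized on the other side. *)
Lemma compatible_exists c : exists d, compatible p c d.
Proof.
have [s [sI sincr scof]] := ideal_sequence c.
have [t [tI tincr tcof]] := ideal_sequence (~` c).
have [||n||d [dU dV dI dD]] := @interpolation (fun n => (s n).2) (fun n => (t n).2)
    (snd @` p).
- exact: sincr.
- exact: tincr.
- have [ps fs] := sI n; have [pt ft] := tI n.
  move: ps pt; case: (s n) fs => a b /= fs; case: (t n) ft => a' b' /= ft ps pt.
  apply/(fin_subalgebra_fin pA (fin_subalgebraI pA ps pt)).
  apply: sub_finite_set (_ : _ `<=` (a `&` c) `|` (a' `\` c)) _.
    by move=> x [ax ax']; have [cx|ncx] := EM (c x); [left|right].
  by rewrite finite_setU.
- exact: sub_countable (card_image_le _ _) pct.
exists d => a b pab; have Xb : (snd @` p) b by exists (a, b).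
split; (split; last apply: contraPP).
- move=> /(scof _ _ pab)[n bn]; apply: sub_finite_set (dU n).
  exact: setSI.
- move=> ac; apply: dI => // n; have [ps fs] := sI n.
  exact: infinite_off_ideal ac.
- move=> /(tcof _ _ pab)[n bn]; apply: sub_finite_set (dV n).
  exact: setSD.
- move=> ac; apply: dD => // n; have [pt ft] := tI n.
  exact: infinite_off_ideal ac.
Qed.

(** Interpolation is used twice. First c is found inside s @` B so thin that it
almost contains no infinite first entry a, nor the image of the trace on B of a second
entry b if that trace is infinite; so the only elements below c are finite, and c imposes no lower bound on
its partner. Then d is found almost disjoint from S, the preimage of c: the
second entries that have to meet d in an infinite set are still infinite off S. *)
Lemma compatible_escape (B : set nat) (s : nat -> nat) :
    infinite_set B -> {in B &, injective s} ->
  exists c d, [/\ compatible p c d, c `<=` s @` B &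
    infinite_set ((B `&` s @^-1` c) `\` d)].
Proof.
move=> Binf sinj.
have img_inf A : A `<=` B -> infinite_set A -> infinite_set (s @` A).
  move=> AB; apply: contra_not; apply: finite_image_inj.
  by move=> x y /set_mem/AB/mem_set xB /set_mem/AB/mem_set; apply: sinj.
have pXct : countable [set s @` (B `&` ab.2) | ab in p].
  exact: sub_countable (card_image_le _ _) pct.
have p1ct : countable (fst @` p).
  exact: sub_countable (card_image_le _ _) pct.
have p2ct : countable (snd @` p).
  exact: sub_countable (card_image_le _ _) pct.
have [||n||c0 [c0B _ c0I c0D]] := @interpolation (fun=> ~` (s @` B)) (fun=> set0)
    ([set s @` B] `|` (fst @` p `|` [set s @` (B `&` ab.2) | ab in p])).
- by move=> _ x.
- by move=> _ x.
- by rewrite setI0; exact: finite_set0.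
- by apply: countable_setU; [exact: countable1|exact: countable_setU].
pose c := c0 `&` s @` B.
have cD x : (fst @` p `|` [set s @` (B `&` ab.2) | ab in p]) x ->
    infinite_set x -> infinite_set (x `\` c).
  move=> Xx xinf; apply: (@sub_infinite_set _ (x `\` c0)).
    by move=> y [xy nc0y]; split=> // -[].
  by apply: c0D; [right|rewrite setD0].
have cinf : infinite_set c.
  rewrite /c setIC; apply: c0I; first by left.
  by move=> _; rewrite setDE setCK setIid; exact: img_inf.
pose S := B `&` s @^-1` c.
have sS : s @` S = c.
  apply/seteqP; split=> [_ [x [_ sx] <-]//|y cy].
  by have [_ [x Bx sxy]] := cy; exists x => //; split=> //; rewrite /= sxy.
have Sinf : infinite_set S by move=> /(finite_image s); rewrite sS.
have offS a b : p (a, b) -> infinite_set b -> infinite_set (b `\` S).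
  move=> pab binf fbS; have : infinite_set (s @` (B `&` b)).
    apply: img_inf => [|fBb]; first exact: subIsetl.
    apply: binf; apply: sub_finite_set (_ : _ `<=` (b `\` S) `|` (B `&` b)) _.
      by move=> x bx; have [[Bx _]|] := EM (S x); [right|left].
    by rewrite finite_setU.
  move/cD; apply; first by right; exists (a, b).
  apply: sub_finite_set (finite_image s fbS) => _ [[x [Bx bx] <-] ncx].
  by exists x => //; split=> // -[].
have [t [tI tincr tcof]] := ideal_sequence c.
have [||n|//|d [dU _ dI dD]] := @interpolation (fun n => (t n).2 `|` S)
    (fun=> set0) (snd @` p).
- by move=> n; apply: setSU.
- by move=> _ x.
- by rewrite setI0; exact: finite_set0.
(* d is almost disjoint from S since S is part of each set to be avoided. *)
have Sd : infinite_set (S `\` d).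
  move=> fSd; apply: Sinf.
  apply: sub_finite_set (_ : _ `<=` (S `\` d) `|` (((t 0%N).2 `|` S) `&` d)) _.
    by move=> x Sx; have [dx|ndx] := EM (d x); [right; split=> //; right|left].
  by rewrite finite_setU.
exists c, d; split=> //; last by move=> y [].
move=> a b pab; have Xb : (snd @` p) b by exists (a, b).
split; split.
- move=> /(tcof _ _ pab)[n bn]; apply: sub_finite_set (dU n).
  by apply: setSI => x bx; left; exact: bn.
- apply: contraPP => ac; apply: dI => // n; have [pt ft] := tI n.
  rewrite -setDDl; case: (t n) pt ft => a' b' pt ft /=.
  apply: (offS (a `\` a')); first exact: fin_subalgebraD.
  exact: (infinite_off_ideal pt ft pab ac).
- move=> fac; apply: (sub_finite_set (@subDsetl _ _ _)).
  apply/(fin_subalgebra_fin pA pab); apply: contrapT => /cD; apply=> //.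
  by left; exists (a, b).
- move=> fbd; apply: (sub_finite_set (@subDsetl _ _ _)).
  apply/(fin_subalgebra_fin pA pab); apply: contrapT => binf.
  by apply: dD fbd => // n; rewrite setD0.
Qed.

End extension.

(** * A generic chain under the continuum hypothesis *)

(** If some initial segment of a well-order of the power set is uncountable, the
least such segment has the size of the continuum by CH and all its proper
initial segments are countable; pull its order back along an injection. *)
Lemma CH_order : CH -> exists lt : set nat -> set nat -> Prop,
  [/\ well_founded lt, forall x y, [\/ lt x y, x = y | lt y x] &
      forall x, countable [set y | lt y x]].
Proof.
move=> HCH; have [R Rwo] := well_ordering_principle (set nat).
pose lt x y := ~ R y x.
have Rmin (A : set (set nat)) : A !=set0 ->
    exists! x, A x /\ forall y, A y -> R x y.
  have memE x : (x \in [pred x | x \in A]) = A x :> Prop by rewrite !inE.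
  have minE x : minimum_of R [pred x | x \in A] x <-> A x /\ forall y, A y -> R x y.
    by rewrite /minimum_of memE; split=> -[Ax lbx]; split=> // y; [rewrite -memE|rewrite memE];
      exact: lbx.
  move=> [x0 Ax0]; have [|x [/minE xmin xuniq]] := Rwo [pred x | x \in A].
    by exists x0; rewrite memE.
  by exists x; split=> // y /minE/xuniq.
have min (A : set (set nat)) : A !=set0 -> exists2 x, A x & forall y, A y -> ~ lt y x.
  by move=> /Rmin[x [[Ax xmin] _]]; exists x => // y Ay; apply; exact: xmin.
have ltT x y : [\/ lt x y, x = y | lt y x].
  have [Ryx|] := EM (R y x); last by constructor 1.
  have [Rxy|] := EM (R x y); last by constructor 3.
  have Rxx z : R z z.
    by have [_ [[-> tmin] _]] := Rmin [set z] (ex_intro _ z erefl); apply: tmin.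
  have [|t [_ tuniq]] := Rmin [set x; y]; first by exists x; left.
  by constructor 2; rewrite -(tuniq x) ?(tuniq y)//; split;
    [right|move=> _ [->|->]|left|move=> _ [->|->]].
have ltwf : well_founded lt.
  move=> x; apply: contrapT => nx.
  have [y ny ymin] := min [set x | ~ Acc lt x] (ex_intro _ x nx).
  by apply: ny; constructor => z zy; apply: contrapT => /ymin.
have [ct|] := EM (forall x, countable [set y | lt y x]); first by exists lt.
move=> /existsNP nct; have [x0 x0ct x0min] := min [set x | ~ countable [set y | lt y x]] nct.
have [/x0ct//|] := HCH [set y | lt y x0].
rewrite card_eq_le => /andP[_ /pcard_leP[f]].
exists (fun x y => lt (f x) (f y)); split.
- suff facc u : Acc lt u -> forall x, f x = u -> Acc (fun x y => lt (f x) (f y)) x.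
    by move=> x; exact: facc (ltwf (f x)) _ erefl.
  elim=> {}u _ IH x fxu; constructor => y yx.
  by apply: (IH (f y)); rewrite // -fxu.
- move=> x y; have [|/(@inj _ _ _ f)|] := ltT (f x) (f y).
  + by constructor 1.
  + by move=> /(_ (mem_set I) (mem_set I)) ->; constructor 2.
  + by constructor 3.
- move=> x; have fct : countable [set y | lt y (f x)].
    by apply: contrapT => /x0min; apply; exact: (@funS _ _ _ _ f x).
  have [g ginj] := pcard_injP fct; apply/pcard_injP; exists (g \o f).
  move=> y z /set_mem yx /set_mem zx gyz.
  apply: (@inj _ _ _ f); [exact: mem_set|exact: mem_set|].
  by apply: ginj => //; exact: mem_set.
Qed.

Section generic_chain.
Variables (W T : Type) (lt : W -> W -> Prop).
Hypotheses (ltwf : well_founded lt)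
  (lt_total : forall x y, [\/ lt x y, x = y | lt y x])
  (lt_countable : forall x, countable [set y | lt y x]).
Variables (P : set (set T)) (p0 : set T) (D : W -> set (set T)).
Hypotheses (P0 : P p0) (p0_min : forall p, P p -> p0 `<=` p)
  (P_union : forall C : set (set T), countable C -> C `<=` P -> C !=set0 ->
     (forall p q, C p -> C q -> p `<=` q \/ q `<=` p) ->
     P (\bigcup_(p in C) p))
  (P_dense : forall w p, P p -> exists q, [/\ P q, p `<=` q & D w q]).

(** Rasiowa-Sikorski for a sigma-closed order and omega_1 dense sets: at w, extend the
union of the chain built before w, which is countable, into the dense set
D w. The least element p0 starts the recursion. *)
Lemma generic_chain : exists C : set (set T),
  [/\ C `<=` P, (forall p q, C p -> C q -> p `<=` q \/ q `<=` p) &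
      forall w, exists2 q, C q & D w q].
Proof.
have [nxt nxtP] : exists nxt : W -> set T -> set T, forall w p, P p ->
    [/\ P (nxt w p), p `<=` nxt w p & D w (nxt w p)].
  suff /choice[f fP] : forall wp : W * set T, exists q, P wp.2 ->
      [/\ P q, wp.2 `<=` q & D wp.1 q].
    by exists (fun w p => f (w, p)) => w p; exact: fP (w, p).
  move=> [w p] /=; have [/(P_dense w)[q qP]|nP] := EM (P p); first by exists q.
  by exists p0.
pose F w (rec : forall y, lt y w -> set T) : set T :=
  nxt w (p0 `|` [set t | exists y (yw : lt y w), rec y yw t]).
pose f := Fix ltwf (fun=> set T) F.
have fE w : f w = nxt w (p0 `|` \bigcup_(y in [set y | lt y w]) f y).
  rewrite /f Fix_eq; last first.
    move=> x g h gh; congr F; apply: functional_extensionality_dep => y.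
    exact: funext.
  congr (nxt w (_ `|` _)); apply/seteqP; split=> [t [y [yw fy]]|t [y yw fy]].
    by exists y.
  by exists y, yw.
have fP w : [/\ P (f w), D w (f w) & forall y, lt y w -> f y `<=` f w].
  elim/(well_founded_ind ltwf): w => w IH.
  pose C := p0 |` (f @` [set y | lt y w]).
  have -> : f w = nxt w (\bigcup_(p in C) p).
    by rewrite fE /C bigcup_setU bigcup_set1 bigcup_image.
  have PC : P (\bigcup_(p in C) p).
    apply: P_union.
    - apply: countable_setU; first exact: countable1.
      exact: sub_countable (card_image_le _ _) (lt_countable w).
    - by move=> p [->//|[y yw <-]]; have [] := IH y yw.
    - by exists p0; left.
    - move=> p q [->|[y yw <-]] [->|[z zw <-]].
      + by left.
      + by left; apply: p0_min; have [] := IH z zw.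
      + by right; apply: p0_min; have [] := IH y yw.
      + have [yz|->|zy] := lt_total y z.
        * by left; have [_ _] := IH z zw; apply.
        * by left.
        * by right; have [_ _] := IH y yw; apply.
  have [Pn sub Dn] := nxtP w _ PC; split=> // y yw t fyt; apply: sub.
  by exists (f y) => //; right; exists y.
exists (range f); split.
- by move=> _ [w _ <-]; have [] := fP w.
- move=> _ _ [y _ <-] [z _ <-]; have [yz|->|zy] := lt_total y z.
  + by left; have [_ _] := fP z; apply.
  + by left.
  + by right; have [_ _] := fP y; apply.
- by move=> w; exists (f w); [exists w|have [] := fP w].
Qed.

End generic_chain.

(** * A nowhere trivial automorphism of the power set modulo finite sets *)

(** A single set of integers codes the restriction of s to B, so that the sets of
integers also enumerate the injections to be escaped from. *)
Definition restricted_graph (B : set nat) (s : nat -> nat) : set nat :=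
  [set choice.pickle (m, s m) | m in B].

Lemma restricted_graph_inj B B' s s' :
  restricted_graph B s = restricted_graph B' s' ->
  B = B' /\ {in B, s =1 s'}.
Proof.
move=> gE; have sub B1 B2 s1 s2 : restricted_graph B1 s1 = restricted_graph B2 s2 ->
    forall m, B1 m -> B2 m /\ s1 m = s2 m.
  move=> g12 m B1m; have : restricted_graph B1 s1 (choice.pickle (m, s1 m)) by exists m.
  by rewrite g12 => -[k B2k /(pcan_inj choice.pickleK)[<- <-]].
split; last by move=> m /set_mem /(sub _ _ _ _ gE)[].
by apply/seteqP; split=> m; [move/(sub _ _ _ _ gE)|move/(sub _ _ _ _ (esym gE))]; case.
Qed.

(** No subalgebra that contains p and is the graph of an isomorphism modulo finite sets
can be induced by s on B: that would make d almost contain the preimage of c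
in B. *)
Definition escapes (p : set (set nat * set nat)) (B : set nat) (s : nat -> nat) :=
  exists c d, [/\ p (c, d), c `<=` s @` B & infinite_set ((B `&` s @^-1` c) `\` d)].

Lemma escapes_sub p q B s : p `<=` q -> escapes p B s -> escapes q B s.
Proof. by move=> pq [c [d [/pq pcd cB Binf]]]; exists c, d. Qed.

Lemma countable_fin_subalgebra_step p (w : set nat) :
    countable p -> fin_subalgebra p ->
  exists q, [/\ countable q /\ fin_subalgebra q, p `<=` q &
    [/\ exists d, q (w, d), exists c, q (c, w) &
      forall B s, infinite_set B -> {in B &, injective s} ->
        w = restricted_graph B s -> escapes q B s]].
Proof.
move=> pct pA.
have [d pwd] := compatible_exists pA pct w.
pose p1 := adjoin p w d.
have p1A : fin_subalgebra p1 by exact: adjoin_fin_subalgebra.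
have p1ct : countable p1 by exact: adjoin_countable.
have sp1ct : countable (swap p1).
  apply: (@sub_countable _ _ _ ((fun ab => (ab.2, ab.1)) @` p1)).
    by apply: subset_card_le => -[a b] /= pba; exists (b, a).
  exact: sub_countable (card_image_le _ _) p1ct.
have [c p1wc] := compatible_exists (swap_fin_subalgebra p1A) sp1ct w.
have {}p1wc : compatible p1 c w.
  move=> a b p1ab; have [h1 h2] := p1wc b a p1ab; split.
    by split=> /h1.
  by split=> /h2.
pose p2 := adjoin p1 c w.
have p2A : fin_subalgebra p2 by exact: adjoin_fin_subalgebra.
have p2ct : countable p2 by exact: adjoin_countable.
have p2wd : p2 (w, d) by do 1!apply: adjoin_sub; exact: adjoin_mem.
have p2cw : p2 (c, w) by exact: adjoin_mem.
have pp2 : p `<=` p2 by apply: (subset_trans (@adjoin_sub _ w d)); exact: adjoin_sub.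
have [[B [s [Binf sinj wE]]]|nw] := EM (exists B s,
    [/\ infinite_set B, {in B &, injective s} & w = restricted_graph B s]); last first.
  exists p2; split=> //; split; [by exists d|by exists c|].
  by move=> B s Binf sinj wE; case: nw; exists B, s.
have [c' [d' [p2cd c'B c'd']]] := compatible_escape p2A p2ct Binf sinj.
have p2p3 : p2 `<=` adjoin p2 c' d' by exact: adjoin_sub.
exists (adjoin p2 c' d'); split.
- by split; [exact: adjoin_countable|exact: adjoin_fin_subalgebra].
- exact: subset_trans pp2 p2p3.
split; [by exists d; exact: p2p3|by exists c; exact: p2p3|].
move=> B' s' _ _; rewrite wE => /restricted_graph_inj[<- ss'].
exists c', d'; split; first exact: adjoin_mem.
- by move=> x /c'B[m Bm <-]; exists m => //; rewrite ss'//; exact: mem_set.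
- apply: sub_infinite_set c'd' => m [[Bm c'm] nd'm]; split=> //; split=> //=.
  by rewrite -ss'//; exact: mem_set.
Qed.

(** All properties of a subalgebra but countability pass to the union of the chain,
hence to the union over all sets of integers. *)
Theorem CH_escaping_automorphism : CH -> exists G : set (set nat * set nat),
  [/\ fin_subalgebra G, forall a, exists b, G (a, b), forall b, exists a, G (a, b) &
      forall B s, infinite_set B -> {in B &, injective s} -> escapes G B s].
Proof.
move=> /CH_order[lt [ltwf ltT ltct]].
pose P p := countable p /\ fin_subalgebra p.
pose p0 : set (set nat * set nat) := [set (set0, set0); (setT, setT)].
pose D (w : set nat) q := [/\ exists d, q (w, d), exists c, q (c, w) &
      forall B s, infinite_set B -> {in B &, injective s} ->
        w = restricted_graph B s -> escapes q B s].
have P0 : P p0.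
  split; first by apply: countable_setU; exact: countable1.
  split=> [|a b|a b a' b'|a b].
  - by right.
  - by move=> [] [-> ->]; rewrite ?setC0 ?setCT; [right|left].
  - by move=> [] [-> ->] [] [-> ->]; rewrite ?set0I ?setTI; [left|left|left|right].
  - by move=> [] [-> ->].
have p0_min p : P p -> p0 `<=` p.
  move=> [_ pA] _ [->|->]; [exact: fin_subalgebra0|exact: fin_subalgebraT].
have dirA (C : set (set (set nat * set nat))) :
    (forall p, C p -> fin_subalgebra p) -> C !=set0 ->
    (forall p q, C p -> C q -> p `<=` q \/ q `<=` p) ->
    fin_subalgebra (\bigcup_(p in C) p).
  move=> CA [p Cp] Cch; split.
  - by exists p => //; apply: fin_subalgebraT; exact: CA.
  - by move=> a b [q Cq qab]; exists q => //; apply: fin_subalgebraC => //; exact: CA.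
  - move=> a b a' b' [q Cq qab] [r Cr rab]; have [qr|rq] := Cch _ _ Cq Cr.
      by exists r => //; apply: fin_subalgebraI => //; [exact: CA|exact: qr].
    by exists q => //; apply: fin_subalgebraI => //; [exact: CA|exact: rq].
  - by move=> a b [q Cq qab]; apply: (fin_subalgebra_fin (CA _ Cq)).
have [||C [CP Cch CD]] := generic_chain ltwf ltT ltct (D := D) P0 p0_min.
- move=> C Cct CP C0 Cch; split; last by apply: dirA => // p /CP[].
  by apply: bigcup_countable => // p /CP[].
- by move=> w p [pct pA]; exact: countable_fin_subalgebra_step.
have CG p : C p -> p `<=` \bigcup_(p in C) p by move=> Cp; exact: bigcup_sup.
exists (\bigcup_(p in C) p); split.
- apply: dirA => //; first by move=> p /CP[].
  by have [q Cq _] := CD set0; exists q.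
- by move=> a; have [q Cq [[d qad] _ _]] := CD a; exists d; exists q.
- by move=> b; have [q Cq [_ [c qcb] _]] := CD b; exists c; exists q.
- move=> B s Binf sinj; have [q Cq [_ _ qesc]] := CD (restricted_graph B s).
  by apply: escapes_sub (CG _ Cq) _; exact: qesc.
Qed.

(** * The Stone dual of the automorphism *)

Section ultrafilters.
Implicit Types (y z : Nstar) (A B : set nat).

Lemma Nstar_ext y z : (forall A, Nstar_filter y A <-> Nstar_filter z A) -> y = z.
Proof.
case: y z => [F FU Ff] [G GU Gf] /= FG.
have E : F = G by apply/funext => A; apply/propext.
by move: FU Ff; rewrite E => FU Ff; congr MkNstar; exact: Prop_irrelevance.
Qed.

Lemma NstarC y A : Nstar_filter y (~` A) <-> ~ Nstar_filter y A.
Proof.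
split=> [yC yA|]; first by have [x []] := filter_ex (filterI yA yC).
by have [//|] := in_ultra_setVsetC A (Nstar_ultra y).
Qed.

Lemma NstarI y A B : Nstar_filter y (A `&` B) <-> Nstar_filter y A /\ Nstar_filter y B.
Proof.
split=> [yAB|[]]; last exact: filterI.
by split; apply: filterS yAB => n [].
Qed.

Lemma Nstar_infinite y A : Nstar_filter y A -> infinite_set A.
Proof. by move=> yA /(Nstar_cofinite y)/NstarC. Qed.

Lemma Nstar_of_ultra (F : set_system nat) : ProperFilter F ->
  (forall A, F A \/ F (~` A)) -> (forall A, F A -> infinite_set A) ->
  exists y, Nstar_filter y = F.
Proof.
move=> FP FC Finf; have FU : UltraFilter F.
  split=> // G GP FG; apply/seteqP; split=> // A GA.
  have [//|/FG GCA] := FC A.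
  by have [n []] := filter_ex (filterI GA GCA).
suff Ffree n : F <> principal_filter n by exists (MkNstar FU Ffree).
move=> Fn; have : F [set n] by rewrite Fn; apply/principal_filterP.
by move/Finf; apply; exact: finite_set1.
Qed.

Lemma Nstar_exists_mem A : infinite_set A -> exists y, Nstar_filter y A.
Proof.
move=> Ainf; pose F : set_system nat := [set B | finite_set (A `\` B)].
have FP : ProperFilter F.
  split; first by rewrite /F /= setD0.
  split=> [|B C|B C BC].
  - by rewrite /F /= setDT.
  - by rewrite /F /= setDIr finite_setU.
  - by apply: sub_finite_set; exact: setDS.
have [U [UU FU]] := ultraFilterLemma FP.
have [|B UB fB|y yU] := @Nstar_of_ultra U _.
- by move=> B; exact: in_ultra_setVsetC.
- have UCB : U (~` B).
    by apply: FU; rewrite /F /= setDE setCK; apply: sub_finite_set fB; exact: subIsetr.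
  by have [n []] := filter_ex (filterI UB UCB).
- by exists y; rewrite yU; apply: FU; rewrite /F /= setDv.
Qed.

Lemma Nstar_hausdorff_star y z : y <> z -> exists2 A, star A y & star (~` A) z.
Proof.
move=> yz; apply: contrapT => nA; apply: yz; apply: Nstar_ext => A; split=> hA.
  by apply: contrapT => /NstarC zA; apply: nA; exists A.
by apply: contrapT => /NstarC yA; apply: nA; exists (~` A); rewrite // /star /= setCK.
Qed.

Lemma closure_star F y : closure F y <-> forall A, star A y -> star A `&` F !=set0.
Proof.
split=> [clF A yA|FA U].
  by rewrite setIC; apply: clF; apply: open_nbhs_nbhs; split=> //; exact: star_open.
rewrite nbhsE => -[V [[D _ <-] [A DA yA]] VU].
have [z [zA Fz]] := FA A yA.
by exists z; split=> //; apply: VU; exists A.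
Qed.

End ultrafilters.

Section dual_map.
Variable G : set (set nat * set nat).
Hypotheses (GA : fin_subalgebra G) (Gdom : forall a, exists b, G (a, b)).

(** The point dual to y consists of the first entries of the pairs whose second entry
is in y. As two second entries for the same set differ by a finite set, the choice
of the pair does not matter. *)
Lemma dual_point (y : Nstar) : exists z : Nstar,
  forall a b, G (a, b) -> (Nstar_filter z a <-> Nstar_filter y b).
Proof.
have wd a b b' : G (a, b) -> G (a, b') -> Nstar_filter y b -> Nstar_filter y b'.
  move=> Gab Gab' yb; apply: contrapT => /NstarC ycb'.
  apply: (Nstar_infinite (filterI yb ycb')).
  apply/(fin_subalgebra_fin GA (fin_subalgebraD GA Gab Gab')).
  by rewrite setDv.
pose F : set_system nat := [set a | exists2 b, G (a, b) & Nstar_filter y b].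
have FE a b : G (a, b) -> (F a <-> Nstar_filter y b).
  by move=> Gab; split=> [[b' Gab' yb']|yb]; [exact: wd Gab' Gab yb'|exists b].
have Finf a : F a -> infinite_set a.
  move=> [b Gab /Nstar_infinite]; apply: contra_not.
  by have [] := fin_subalgebra_fin GA Gab.
have FP : ProperFilter F.
  split; first by move=> /Finf; apply.
  split.
  - by exists setT; [exact: fin_subalgebraT|exact: filterT].
  - move=> a a' [b Gab yb] [b' Gab' yb']; exists (b `&` b').
      exact: fin_subalgebraI.
    exact: filterI.
  - move=> a a' aa' [b Gab yb]; have [b' Gab'] := Gdom a'.
    exists b' => //; have : F (a `&` a') by rewrite (setIidl aa'); exists b.
    by rewrite (FE _ _ (fin_subalgebraI GA Gab Gab')) NstarI => -[].
have [|//|z zF] := @Nstar_of_ultra F FP.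
  move=> a; have [b Gab] := Gdom a.
  have [yb|/NstarC yb] := EM (Nstar_filter y b); [left|right]; first by exists b.
  by exists (~` b) => //; exact: fin_subalgebraC.
by exists z; rewrite zF.
Qed.

End dual_map.

Definition dual_of (G : set (set nat * set nat)) (h : Nstar -> Nstar) :=
  forall y a b, G (a, b) -> (Nstar_filter (h y) a <-> Nstar_filter y b).

Lemma dual_of_exists G : fin_subalgebra G -> (forall a, exists b, G (a, b)) ->
  exists h, dual_of G h.
Proof. by move=> GA Gdom; have [h hP] := choice (dual_point GA Gdom); exists h. Qed.

(** The converse relation dualizes to the inverse homeomorphism. *)
Lemma dual_of_swapK G h h' : (forall b, exists a, G (a, b)) ->
  dual_of G h -> dual_of (swap G) h' -> cancel h h'.
Proof.
move=> Gran hG h'G y; apply: Nstar_ext => b; have [a Gab] := Gran b.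
by rewrite (h'G _ b a Gab) (hG _ _ _ Gab).
Qed.

Lemma dual_of_continuous G h : (forall a, exists b, G (a, b)) ->
  dual_of G h -> continuous h.
Proof.
move=> Gdom hG; apply/continuousP => _ [D _ <-].
rewrite preimage_bigcup; apply: bigcup_open => A _.
have [b Gab] := Gdom A; rewrite (_ : _ @^-1` _ = star b); first exact: star_open.
by apply/seteqP; split=> y /=; rewrite /star /= (hG _ _ _ Gab).
Qed.

Lemma nowhere_dense_sub (T : topologicalType) (A B : set T) :
  A `<=` B -> nowhere_dense B -> nowhere_dense A.
Proof.
rewrite /nowhere_dense -!subset0 => AB; apply: subset_trans.
by apply: interiorS; exact: closureS.
Qed.

Lemma nowhere_dense_preimage (T : topologicalType) (h h' : T -> T) (F : set T) :
  continuous h -> continuous h' -> cancel h' h -> cancel h h' -> nowhere_dense F ->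
  nowhere_dense (h @^-1` (closure F)).
Proof.
move=> hc h'c h'K hK Fnd; rewrite /nowhere_dense -subset0 => y.
have hF : closed (h @^-1` closure F).
  by apply: preimage_closed; [move=> x _; exact: hc|exact: closed_closure].
rewrite -(proj1 (closure_id _) hF) => Uy.
suff : (closure F)° (h y) by rewrite Fnd.
have : h' @^-1` (h @^-1` closure F)° `<=` (closure F)°.
  rewrite -open_subsetE; last first.
    by move/continuousP : h'c; apply; exact: open_interior.
  by move=> z /interior_subset /=; rewrite h'K.
by apply; rewrite /= hK.
Qed.

(** * The representation on continuous functions *)

Section hat.
Variable R : realType.
Local Notation X := (linf_c0 R nat).
Implicit Types (f g : linf R nat) (y z : Nstar) (x : X).

Lemma hat_near f y (e : R) : 0 < e ->
  Nstar_filter y [set n | `|hat (cls f) y - f n| < e].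
Proof. by move=> e0; rewrite hat_cls; have /cvgrPdist_lt := @cvg_ultra R f y; exact. Qed.

Lemma hat_dist_le f y (l e : R) :
  Nstar_filter y [set n | `|f n - l| <= e] -> `|hat (cls f) y - l| <= e.
Proof.
move=> yfl; apply/ler_addgt0Pr => d d0.
have [n [/= fl fh]] := filter_ex (filterI yfl (hat_near f y d0)).
have := ler_normD (hat (cls f) y - f n) (f n - l).
by rewrite addrA subrK; lra.
Qed.

Lemma hatD x x' y : hat (x + x') y = hat x y + hat x' y.
Proof.
rewrite -[x]repr_cls -[x']repr_cls -raddfD !hat_cls.
by rewrite -limD//; exact: cvg_ultra.
Qed.

Lemma hatZ (a : R) x y : hat (a *: x) y = a * hat x y.
Proof.
rewrite -[x]repr_cls -linearZ /= !hat_cls.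
by apply: cvg_lim => //; apply: cvgZr; exact: cvg_ultra.
Qed.

Lemma hat_norm_le x y : `|hat x y| <= `|x|.
Proof.
apply: quot_norm_ge => f <-; rewrite -[hat _ _]subr0; apply: hat_dist_le.
apply: filterS (@filterT _ y _) => n _ /=; rewrite subr0; exact: le_sup_norm.
Qed.

(** Together with [hat_norm_le] this makes hat isometric. The set where |f| is at
least M + e is finite, since a point of Nstar containing it would give the
extension a value of modulus above M; setting f to zero there does not change its class. *)
Lemma norm_le_hat x (M : R) : (forall y, `|hat x y| <= M) -> `|x| <= M.
Proof.
move=> xM; have M0 : 0 <= M by exact: le_trans (xM point).
rewrite -[x]repr_cls; set f := repr x; apply/ler_addgt0Pr => e e0.
have fin : finite_set [set n | M + e <= `|f n|].
  apply: contrapT => /Nstar_exists_mem[y yf].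
  have := xM y; rewrite -[x]repr_cls -/f => fM.
  have [n [/= Mf ff]] := filter_ex (filterI yf (hat_near f y e0)).
  have := ler_normD (hat (cls f) y) (f n - hat (cls f) y).
  rewrite addrC subrK => ?; rewrite distrC in ff; lra.
pose g0 (n : nat) : R^o := if M + e <= `|f n| then 0 else f n.
have g0b n : `|g0 n| <= M + e.
  rewrite /g0; case: (leP (M + e) `|f n|) => [_|/ltW//].
  by rewrite (_ : `|0| = 0); [lra|exact: normr0].
have g0P : g0 \in @bounded_family R nat.
  by apply/bounded_familyP; exists (M + e).
have -> : cls f = cls (Linf g0P).
  apply/clsP/c0P => d d0; apply: sub_finite_set fin => n /=.
  rewrite [X in _ <= `|X|](_ : _ = f n - g0 n)// /g0.
  by case: (leP (M + e) `|f n|) => // _; rewrite subrr normr0 leNgt d0.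
apply: le_trans (quot_norm_le _) _; apply: sup_norm_le => //; lra.
Qed.

Lemma hat_inj x x' : (forall y, hat x y = hat x' y) -> x = x'.
Proof.
move=> xx'; apply/subr0_eq/eqP; rewrite -normr_le0; apply: norm_le_hat => y.
by rewrite hatD -scaleN1r hatZ xx' mulN1r subrr normr0.
Qed.

Lemma indic_bounded_family (a : set nat) :
  (\1_a : nat -> R^o) \in @bounded_family R nat.
Proof.
apply/bounded_familyP; exists 1 => n.
by rewrite indicE; case: (_ \in _); rewrite ?normr1 ?normr0.
Qed.

Definition indic_linf (a : set nat) : linf R nat := Linf (indic_bounded_family a).

Lemma hat_indic (a : set nat) y : Nstar_filter y a -> hat (cls (indic_linf a)) y = 1.
Proof.
move=> ya; apply/subr0_eq/normr0_eq0/le_anti; rewrite normr_ge0 andbT.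
apply: hat_dist_le; apply: filterS ya => n an /=.
by rewrite indicE mem_set// subrr normr0.
Qed.

Lemma hat_indicC (a : set nat) y : ~ Nstar_filter y a -> hat (cls (indic_linf a)) y = 0.
Proof.
move=> /NstarC ya; apply/subr0_eq/normr0_eq0/le_anti; rewrite normr_ge0 andbT.
apply: hat_dist_le; apply: filterS ya => n an /=.
by rewrite indicE memNset// subrr normr0.
Qed.

End hat.

(** * The composition operator of a dual map *)

Lemma Nstar_decides (y : Nstar) (b : nat -> set nat) K :
  Nstar_filter y [set n | forall k, (k < K)%N ->
    `[< b k n >] = `[< Nstar_filter y (b k) >]].
Proof.
elim: K => [|K IH]; first by apply: filterS (@filterT _ y _) => n _ k.
have yK : Nstar_filter y [set n | `[< b K n >] = `[< Nstar_filter y (b K) >]].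
  have [yb|nyb] := EM (Nstar_filter y (b K)).
    by apply: filterS (yb) => n bn /=; rewrite !asboolT.
  by move/NstarC : (nyb); apply: filterS => n bn /=; rewrite !asboolF.
apply: filterS (filterI IH yK) => n [/= nK nk] k.
by rewrite ltnS leq_eqVlt => /orP[/eqP->|/nK].
Qed.

Section binary.
Variable R : realType.
Implicit Types (c : nat -> bool) (t : R).

Definition bsum c K : R := \sum_(k < K) (c k)%:R * 2^-1 ^+ k.+1.

Lemma bsumS c K : bsum c K.+1 = bsum c K + (c K)%:R * 2^-1 ^+ K.+1.
Proof. by rewrite /bsum big_ord_recr. Qed.

Lemma eq_bsum c c' K : (forall k, (k < K)%N -> c k = c' k) -> bsum c K = bsum c' K.
Proof. by move=> cc'; apply: eq_bigr => k _; rewrite cc'. Qed.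

Definition binary_expansion c t := forall K, 0 <= t - bsum c K <= 2^-1 ^+ K.

Lemma binary_expansion_exists t : 0 <= t <= 1 -> exists c, binary_expansion c t.
Proof.
move=> t01; pose r := fix r k := if k is k'.+1 then
  2 * r k' - (2^-1 <= r k')%R%:R else t.
have r01 k : 0 <= r k <= 1.
  elim: k => //= k IH; case: (leP 2^-1 (r k)) => h /=; lra.
exists (fun k => 2^-1 <= r k) => K.
suff -> : t - bsum (fun k => 2^-1 <= r k) K = r K * 2^-1 ^+ K.
  have h : 0 <= 2^-1 ^+ K :> R by rewrite exprn_ge0.
  have /andP[r0 r1] := r01 K; rewrite mulr_ge0//=.
  by rewrite ler_piMl.
elim: K => [|K IH]; first by rewrite /bsum big_ord0 subr0 expr0 mulr1.
rewrite bsumS opprD addrA IH exprS /=; set e := 2^-1 ^+ K; lra.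
Qed.

(** The supremum of the partial sums works because the upper estimates
bsum c K + 2^-K decrease. *)
Lemma binary_expansion_value c : exists t, binary_expansion c t.
Proof.
have e0 K : 0 <= 2^-1 ^+ K :> R by rewrite exprn_ge0.
have up K L : (K <= L)%N -> bsum c K <= bsum c L.
  elim: L => [|L IH]; first by rewrite leqn0 => /eqP->.
  rewrite leq_eqVlt => /orP[/eqP->//|/IH KL].
  by rewrite bsumS (le_trans KL)// lerDl mulr_ge0.
have down K L : (K <= L)%N -> bsum c L + 2^-1 ^+ L <= bsum c K + 2^-1 ^+ K.
  elim: L => [|L IH]; first by rewrite leqn0 => /eqP->.
  rewrite leq_eqVlt => /orP[/eqP->//|/IH KL]; apply: le_trans KL.
  have := e0 L; rewrite bsumS exprS; set e := 2^-1 ^+ L.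
  case: (c L) => /=; lra.
have ub K L : bsum c L <= bsum c K + 2^-1 ^+ K.
  have [KL|/ltnW LK] := leqP K L.
    by apply: le_trans (down _ _ KL); rewrite lerDl.
  by apply: le_trans (up _ _ LK) _; rewrite lerDl.
exists (sup (range (bsum c))) => K; apply/andP; split.
  rewrite subr_ge0; apply: ub_le_sup; last by exists K.
  by exists (bsum c 0%N + 2^-1 ^+ 0) => _ [L _ <-].
rewrite lerBlDl; apply: ge_sup; first by exists (bsum c 0%N), 0%N.
by move=> _ [L _ <-].
Qed.

Lemma le_half_pow_eq0 (M d : R) :
  0 <= d -> (forall K, d <= M * 2^-1 ^+ K) -> d = 0.
Proof.
move=> d0 dM; apply/le_anti; rewrite d0 andbT leNgt; apply/negP => dgt0.
have M0 : 0 <= M by have := dM 0%N; rewrite expr0 mulr1; exact: le_trans.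
have := archi_boundP (divr_ge0 M0 d0); set K := Num.bound _.
rewrite ltr_pdivrMr// ltNge => /negP; apply.
have K2 : K%:R <= 2 ^+ K :> R by rewrite -natrX ler_nat ltnW// ltn_expl.
have := dM K; rewrite exprVn ler_pdivlMr ?exprn_gt0//; apply: le_trans.
by rewrite mulrC ler_wpM2l.
Qed.

End binary.

(** Rescale f to the unit interval, let a k be the set where its k-th digit is one, and
let the k-th digits of the image form a partner b k of a k. Up to 2^-K both limits, of
the image along y and of f along h y, are given by the first K digits, and y
decides b k exactly as h y decides a k. *)
Lemma dual_operator_value (R : realType) G h (x : linf_c0 R nat) :
    (forall a, exists b, G (a, b)) -> dual_of G h ->
  exists z : linf_c0 R nat, forall y, hat z y = hat x (h y).
Proof.
move=> Gdom hG; rewrite -[x]repr_cls; move: (repr x) => {x} f.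
have [M M0 fM] : exists2 M : R, 0 < M & forall n, `|f n| <= M.
  have [M fM] := linfP f; exists (`|M| + 1); first by rewrite ltr_wpDl.
  by move=> n; apply: le_trans (fM n) _; rewrite (le_trans (ler_norm _))// lerDl.
have M20 : 0 < 2 * M by rewrite mulr_gt0.
have /choice[c cf] : forall n, exists c, binary_expansion c ((f n + M) / (2 * M)).
  move=> n; apply: binary_expansion_exists.
  have := fM n; rewrite ler_norml => /andP[fl fr].
  rewrite divr_ge0 ?(ltW M20)//=; last lra.
  by rewrite ler_pdivrMr// mul1r; lra.
pose a k := [set n | c n k].
have [b Gab] := choice (fun k => Gdom (a k)).
have [t tb] := choice (fun n => binary_expansion_value R (fun k => `[< b k n >])).
pose g0 (n : nat) : R^o := 2 * M * t n - M.
have scale (s u : R) K : 0 <= s - u <= 2^-1 ^+ K ->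
    `|(2 * M * s - M) - (2 * M * u - M)| <= 2 * M * 2^-1 ^+ K.
  move=> /andP[s0 s1].
  rewrite (_ : _ - _ = 2 * M * (s - u)); last by lra.
  rewrite ger0_norm; last by rewrite mulr_ge0// ltW.
  by apply: ler_wpM2l => //; exact: ltW.
have g0P : g0 \in @bounded_family R nat.
  apply/bounded_familyP; exists (2 * M + M) => n.
  have := scale _ _ _ (tb n 0%N); rewrite /bsum big_ord0 expr0 mulr1 mulr0 sub0r opprK.
  by rewrite /g0 subrK => h1; rewrite (le_trans (ler_normB _ _))// lerD// gtr0_norm.
exists (cls (Linf g0P)) => y.
apply/subr0_eq/normr0_eq0; apply: (@le_half_pow_eq0 _ (4 * M)) => [//|K].
(* The common value of the first K digits along y and along h y. *)
pose l := 2 * M * bsum R (fun k => `[< Nstar_filter y (b k) >]) K - M.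
have gl : `|hat (cls (Linf g0P)) y - l| <= 2 * M * 2^-1 ^+ K.
  apply: hat_dist_le; apply: filterS (Nstar_decides y b K) => n /= nb.
  by rewrite /l -(eq_bsum R nb); exact: scale (tb n K).
have fl : `|hat (cls f) (h y) - l| <= 2 * M * 2^-1 ^+ K.
  apply: hat_dist_le; apply: filterS (Nstar_decides (h y) a K) => n /= na.
  rewrite /l (@eq_bsum _ _ (c n)) => [|k kK]; last first.
    by rewrite -(asbool_equiv_eq (hG y _ _ (Gab k))) -na// asboolb.
  rewrite (_ : f n = 2 * M * ((f n + M) / (2 * M)) - M); first exact: scale (cf n K).
  by rewrite mulrC divfK ?gt_eqF// addrK.
rewrite (_ : _ - _ = (hat (cls (Linf g0P)) y - l) - (hat (cls f) (h y) - l)); last lra.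
rewrite (le_trans (ler_normB _ _))//; lra.
Qed.

(** * Point masses and the measures that represent them *)

Section representation.
Variable R : realType.
Local Notation X := (linf_c0 R nat).
Local Open Scope ereal_scope.

Lemma measurable_open_Nstar (A : set Nstar) : open A -> measurable (A : set borelNstar).
Proof. by move=> Aop; exact: sub_sigma_algebra. Qed.

Lemma measurable_point (z : Nstar) : measurable ([set z] : set borelNstar).
Proof.
rewrite -[X in measurable X]setCK; apply: measurableC; apply: measurable_open_Nstar.
rewrite (_ : ~` [set z] = \bigcup_(A in [set A | star (~` A) z]) star A).
  by apply: bigcup_open => A _; exact: star_open.
apply/seteqP; split=> [y yz|y [A zA yA] yz].
  by have [A yA zA] := Nstar_hausdorff_star yz; exists A.
by rewrite -yz in zA; move/NstarC : zA; apply.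
Qed.

Lemma measurable_hat (x : X) : measurable_fun [set: borelNstar] (hat x).
Proof.
apply: (measurability _ (measurable_realfun.RGenOpens.measurableE R)).
move=> _ [_ [a [b ->] <-]]; rewrite setTI; apply: measurable_open_Nstar.
by have /continuousP := @hat_continuous R x; apply; exact: interval_open.
Qed.

Lemma charge_variation_null nu A : tot_var nu A = 0 ->
  jordan_pos (hahnP nu) A = 0 /\ jordan_neg (hahnP nu) A = 0 :> \bar R.
Proof.
rewrite /tot_var /= /charge_variation => /eqP.
by rewrite padde_eq0 ?measure_ge0// => /andP[/eqP ? /eqP ?].
Qed.

(** If y had a clopen neighbourhood disjoint from F, this would be a null set of |nu|
and the indicator of the neighbourhood would have integral zero and value one at
y. *)
Lemma represents_closure nu (y : Nstar) F :
  (forall x : X, hat x y = charge_integral nu (hat x)) -> concentrated nu F ->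
  closure F y.
Proof.
move=> nuy [N [mN N0 FN]]; apply/closure_star => A yA; apply: contrapT => AF.
have mA : measurable (star A : set borelNstar) by apply: measurable_open_Nstar; exact: star_open.
have AN : star A `<=` N by move=> z zA; apply: FN => Fz; apply: AF; exists z.
have A0 : tot_var nu (star A) = 0.
  apply/eqP; rewrite eq_le measure_ge0 andbT -N0.
  by apply: le_measure => //; rewrite inE.
have [p0 n0] := charge_variation_null A0.
have hatA : hat (cls (indic_linf R A)) = \1_(star A).
  apply/funext => z; have [zA|zA] := EM (star A z).
    by rewrite hat_indic// indicE mem_set.
  by rewrite hat_indicC// indicE memNset.
have int0 (mu : {measure set borelNstar -> \bar R}) : mu (star A) = 0 ->
    Rintegral mu setT \1_(star A) = 0%R.
  by move=> mu0; rewrite /Rintegral integral_indic// setIT mu0.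
have := nuy (cls (indic_linf R A)); rewrite hat_indic// hatA /charge_integral.
rewrite (int0 _ p0) (int0 _ n0) subrr => /eqP.
by rewrite oner_eq0.
Qed.

Section dirac.
Variable z : Nstar.
Let nu : {charge set borelNstar -> \bar R} := charge_of_finite_measure (\d_(z : borelNstar)).

Lemma jordan_neg_dirac A : jordan_neg (hahnP nu) A = 0.
Proof.
rewrite jordan_negE cjordan_negE /crestr0; case: ifPn => [/set_mem mA|_]; last exact: oppe0.
have [_ [mN neg] _ _] := hahnP nu.
have mAN : measurable (A `&` hahn_neg nu) by exact: measurableI.
suff nuN0 : nu (A `&` hahn_neg nu) = 0 by rewrite /crestr nuN0 oppe0.
apply/le_anti/andP; split; first by apply: neg => //; exact: subIsetr.
exact: (measure_ge0 (\d_(z : borelNstar))).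
Qed.

Lemma jordan_pos_dirac A : measurable A -> jordan_pos (hahnP nu) A = \d_(z : borelNstar) A.
Proof.
move=> mA; transitivity
    (jordan_pos (hahnP nu) A + (-1)%:E * jordan_neg (hahnP nu) A).
  by rewrite jordan_neg_dirac mule0 adde0.
rewrite -[RHS]/(nu A) (jordan_decomp (hahnP nu) mA).
reflexivity.
Qed.

Lemma dirac_variation A : measurable A -> tot_var nu A = \d_(z : borelNstar) A.
Proof.
move=> mA; transitivity (jordan_pos (hahnP nu) A + jordan_neg (hahnP nu) A) => //.
by rewrite jordan_neg_dirac adde0 jordan_pos_dirac.
Qed.

(** The Hahn decomposition comes from a choice, but the negative part of a positive
measure vanishes for each decomposition, so the variation is the point mass
itself. *)
Lemma dirac_represents :
  represents nu (@delta R z) /\ forall H : set Nstar, H z -> concentrated nu H.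
Proof.
split; last first.
  move=> H Hz; exists (~` [set z] : set borelNstar); split.
  - by apply: measurableC; exact: measurable_point.
  - rewrite dirac_variation; last by apply: measurableC; exact: measurable_point.
    by rewrite diracE memNset//; apply.
  - by move=> y nHy yz; apply: nHy; rewrite yz.
split=> [A mA|x].
  apply/le_anti/andP; split.
    rewrite dirac_variation//; apply: le_ereal_sup_tmp.
    have [Az|Az] := EM (A z).
      exists (tot_var nu [set z]); last first.
        by rewrite dirac_variation ?diracE ?mem_set//; exact: measurable_point.
      by exists [set z] => //; split; [exact: compact_set1|move=> _ ->].
    exists (tot_var nu set0); last by rewrite measure0 diracE memNset.
    by exists set0 => //; split; [exact: compact0|].
  apply: ge_ereal_sup => _ [K [_ KA] <-].
  have [mK|nmK] := EM (measurable (K : set borelNstar)).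
    by apply: le_measure => //; rewrite inE.
  have -> : tot_var nu K = jordan_pos (hahnP nu) K + jordan_neg (hahnP nu) K by [].
  by rewrite jordan_neg_dirac adde0 jordan_posE cjordan_posE /crestr0 memNset.
rewrite /delta /charge_integral.
have -> : Rintegral (jordan_pos (hahnP nu)) setT (hat x) = hat x z.
  rewrite /Rintegral (eq_measure_integral (\d_(z : borelNstar))); last first.
    by move=> A mA _; exact: jordan_pos_dirac.
  rewrite integral_dirac//; last by apply/measurable_realfun.measurable_EFinP; exact: measurable_hat.
  by rewrite diracT mul1e.
have -> : Rintegral (jordan_neg (hahnP nu)) setT (hat x) = 0%R.
  rewrite /Rintegral (eq_measure_integral mzero); last first.
    by move=> A _ _; exact: jordan_neg_dirac.
  by rewrite integral_measure_zero.
by rewrite subr0.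
Qed.

End dirac.
End representation.

(** * The operator *)

Section composition_operator.
Variable R : realType.
Local Notation X := (linf_c0 R nat).

Lemma composition_operator_exists (G : set (set nat * set nat)) (h : Nstar -> Nstar) :
    (forall a, exists b, G (a, b)) -> dual_of G h ->
  exists T : {linear X -> X}, forall x y, hat (T x) y = hat x (h y).
Proof.
move=> Gdom hG; have [T0 T0h] := choice (fun x : X => dual_operator_value x Gdom hG).
have T0lin : linear T0.
  by move=> a u v; apply: hat_inj => y; rewrite !(T0h, hatD, hatZ).
pose L := GRing.isLinear.Build R X X *:%R T0 T0lin.
by exists (HB.pack_for {linear X -> X} T0 L).
Qed.

Variables (T : {linear X -> X}) (h h' : Nstar -> Nstar).
Hypotheses (Th : forall x y, hat (T x) y = hat x (h y))
  (hK : cancel h h') (h'K : cancel h' h).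

Lemma composition_norm_le (x : X) : `|T x| <= `|x|.
Proof. by apply: norm_le_hat => y; rewrite Th; exact: hat_norm_le. Qed.

Lemma composition_represents y :
  exists nu, represents nu (adjoint T (@delta R y)) /\
    forall H : set Nstar, H (h y) -> concentrated nu H.
Proof.
have [[nurad nuE] nuH] := dirac_represents R (h y).
eexists; split; last exact: nuH.
by split=> // x; rewrite /adjoint /delta /= Th -nuE.
Qed.

Lemma composition_concentrated_closure y F :
  functional_concentrated (adjoint T (@delta R y)) F -> closure F (h y).
Proof.
move=> [nu [[_ nuE] nuF]]; apply: represents_closure nuF => x.
by rewrite -nuE /adjoint /delta /= Th.
Qed.

(** The points sent by the adjoint to a measure concentrated on F lie in the preimage
of the closure of F. *)
Lemma composition_fountainless : continuous h -> continuous h' -> fountainless T.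
Proof.
move=> hc h'c F Fnd; apply: nowhere_dense_sub (nowhere_dense_preimage hc h'c h'K hK Fnd).
by move=> y [_ /composition_concentrated_closure].
Qed.

Lemma composition_funnelless : continuous h -> continuous h' -> funnelless T.
Proof.
move=> hc h'c F Fnd; exists (h' @^-1` closure F); split.
  exact: nowhere_dense_preimage.
move=> y Fy; have [nu [nurep nuH]] := composition_represents y.
by exists nu; split=> //; apply: nuH; rewrite /= hK; exact: subset_closure.
Qed.

Lemma composition_indic G c d : dual_of G h -> G (c, d) ->
  T (cls (indic_linf R c)) = cls (indic_linf R d).
Proof.
move=> hG Gcd; apply: hat_inj => y; rewrite Th.
have [yd|yd] := EM (Nstar_filter y d).
  by rewrite !hat_indic//; apply/(hG _ _ _ Gcd).
by rewrite !hat_indicC//; apply: contra_not yd => /(hG _ _ _ Gcd).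
Qed.

(** A trivial corner is given by a bijection s of B' onto A'; seen in nat it is an
injection s0 of the infinite set B0. For the pair (c, d) of [escapes], the
corner sends the indicator of c to the indicator of d, while it should be r at
every point of the preimage of c: the difference has modulus |r| on an infinite set. *)
Lemma composition_nowhere_trivial G : dual_of G h ->
    (forall B s, infinite_set B -> {in B &, injective s} -> escapes G B s) ->
  nowhere_trivial T.
Proof.
move=> hG Gesc A B _ Binf [A' [B' [s [r [_ B'cof sbij r0 sT]]]]].
pose B0 : set nat := val @` B'.
have B'inf : infinite_set B'.
  apply: cofinite_set_infinite B'cof => /(finite_image val); apply: contra_not Binf.
  by apply: sub_finite_set => n Bn; exists (SigSub (mem_set Bn)).
have B0inf : infinite_set B0.
  by apply: contra_not B'inf; apply: finite_image_inj => x y _ _; exact: val_inj.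
have B0P n : B0 n -> exists b : B', val (val b) = n.
  by move=> [b B'b <-]; exists (SigSub (mem_set B'b)).
have [s0 s0P] : exists s0 : nat -> nat, forall b : B', s0 (val (val b)) = val (val (s b)).
  have /choice[s0 s0P] : forall n, exists m, forall b : B', val (val b) = n ->
      m = val (val (s b)).
    move=> n; have [[b bn]|nb] := EM (exists b : B', val (val b) = n).
      by exists (val (val (s b))) => b' b'n; congr (val (val (s _)));
        apply/val_inj/val_inj; rewrite bn b'n.
    by exists 0%N => b bn; case: nb; exists b.
  by exists s0 => b; apply: s0P.
have s0inj : {in B0 &, injective s0}.
  move=> m n /set_mem/B0P[b <-] /set_mem/B0P[b' <-].
  by rewrite !s0P => /val_inj/val_inj/(bij_inj sbij) ->.
have [c [d [Gcd csB Sinf]]] := Gesc _ _ B0inf s0inj.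
have cA' n : c n -> exists a : A', val (val a) = n.
  by move=> /csB[_ /B0P[b <-] <-]; exists (s b); rewrite s0P.
pose f : linf R A' := linf_comp (val \o val) (indic_linf R c).
have fE : zero_ext (zero_ext f) = indic_linf R c.
  apply/val_inj/funext => n /=; case: insubP => [a _ an|nA] /=.
    case: insubP => [a' _ a'a|nA'] /=; first by rewrite a'a an.
    rewrite indicE memNset// => /cA'[a' a'n].
    have aa' : a = val a' by apply: val_inj; rewrite an a'n.
    by move/negP : nA'; apply; rewrite aa'; exact: valP.
  rewrite indicE memNset// => /cA'[a' a'n].
  by move/negP : nA; apply; rewrite -a'n; exact: valP.
have := sT f; rewrite /local_op !I_cls fE (composition_indic hG Gcd) P_cls.
move=> /clsP/c0P/(_ `|r|); rewrite normr_gt0 => /(_ r0) /(finite_image val) fin.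
apply: Sinf; apply: sub_finite_set fin => n [[/B0P[b <-] /= sc] nd].
exists (val b) => //=.
rewrite [X in _ <= `|X|](_ : _ = - r) ?normrN//.
rewrite [LHS](_ : _ = \1_d (val (val b)) -
  oapp (r *: linf_comp s f) 0 (insub (val b)))//.
rewrite indicE memNset// valK /= sub0r.
rewrite [X in - X](_ : _ = r * \1_c (val (val (s b))))//.
by rewrite -s0P indicE mem_set// mulr1.
Qed.

End composition_operator.

Theorem theorem6p9 (R : realType) (HCH : CH) :
  exists T : {linear (linf_c0 R nat) -> (linf_c0 R nat)},
    [/\ automorphism T, fountainless T, funnelless T & nowhere_trivial T].
Proof.
have [G [GA Gdom Gran Gesc]] := CH_escaping_automorphism HCH.
have [h hG] := dual_of_exists GA Gdom.
have [h' h'G] := dual_of_exists (swap_fin_subalgebra GA) Gran.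
have hK : cancel h h' by exact: dual_of_swapK hG h'G.
have h'K : cancel h' h by exact: dual_of_swapK (h'G) hG.
have hc := dual_of_continuous Gdom hG.
have h'c := dual_of_continuous Gran h'G.
have [T Th] := composition_operator_exists R Gdom hG.
have [S Sh'] := composition_operator_exists R Gran h'G.
exists T; split.
- split; first by exists 1 => x; rewrite mul1r; exact: composition_norm_le Th x.
  exists S; split.
  + by move=> x; apply: hat_inj => y; rewrite Sh' Th h'K.
  + by move=> x; apply: hat_inj => y; rewrite Th Sh' hK.
  + by exists 1 => x; rewrite mul1r; exact: composition_norm_le Sh' x.
- exact: composition_fountainless Th hK h'K hc h'c.
- exact: composition_funnelless Th hK h'K hc h'c.
- exact: composition_nowhere_trivial Th _ hG Gesc.
Qed.
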